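(* Let $\kappa \le 0$, let $X$ be a CBB$(\kappa)$ space, let $Y$ be a complete CAT$(\kappa)$ space and let $A \subseteq X$ be nonempty. Then there exists a continuous mapping $\alpha_c : \mathcal{N}(A,Y) \to \mathcal{N}(X,Y)$ such that for all $g \in \mathcal{N}(A,Y)$, $\alpha_c(g)(a) = g(a)$ for every $a \in A$ and $\alpha_c(g)(X) \subseteq \overline{\mathrm{co}}(g(A))$.
   Context: For $\kappa\le0$, a geodesic space is CAT$(\kappa)$ (resp. CBB$(\kappa)$) if every geodesic triangle satisfies $\le$ (resp. $\ge$) when comparing distances between points on it with distances between corresponding points of its comparison triangle in the model surface $M^2_\kappa$ of constant curvature $\kappa$. $\mathcal{N}(A,Y)$ is the set of bounded nonexpansive maps $A\to Y$ with the supremum metric. For $C\subseteq Y$, $G_1(C)$ is the union of all geodesic segments with endpoints in $C$, $G_n(C)=G_1(G_{n-1}(C))$, $\mathrm{co}(C)=\bigcup_n G_n(C)$, and $\overline{\mathrm{co}}(C)$ is its closure. *)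

(* Defs.v *)
From Stdlib Require Import Reals Lra.
From Coquelicot Require Import Coquelicot.
Open Scope R_scope.

Record MetricSpace := {
  carrier :> Type;
  dist : carrier -> carrier -> R;
  dist_eq0 : forall x y, dist x y = 0 <-> x = y;
  dist_sym : forall x y, dist x y = dist y x;
  dist_tri : forall x y z, dist x z <= dist x y + dist y z
}.
Arguments dist {m} _ _.

Definition complete (X : MetricSpace) : Prop :=
  forall u : nat -> X,
    (forall eps, 0 < eps -> exists N, forall m n, (N <= m)%nat -> (N <= n)%nat ->
        dist (u m) (u n) < eps) ->
    exists l : X, forall eps, 0 < eps -> exists N, forall n, (N <= n)%nat ->
        dist (u n) l < eps.

Definition sub_ms (X : MetricSpace) (A : X -> Prop) : MetricSpace.
Proof.
  refine {| carrier := {x : X | A x};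
            dist := fun a b => dist (proj1_sig a) (proj1_sig b) |}.
  - intros [x hx] [y hy]; simpl; split.
    + intros h. apply dist_eq0 in h. subst y.
      f_equal. apply Classical_Prop.proof_irrelevance.
    + intros h. inversion h. apply dist_eq0. reflexivity.
  - intros [x hx] [y hy]; simpl; apply dist_sym.
  - intros [x hx] [y hy] [z hz]; simpl; apply dist_tri.
Defined.

Definition geodesic (X : MetricSpace) (gamma : R -> X) (x y : X) : Prop :=
  gamma 0 = x /\ gamma (dist x y) = y /\
  forall s t, 0 <= s <= dist x y -> 0 <= t <= dist x y ->
    dist (gamma s) (gamma t) = Rabs (s - t).

Definition geodesic_space (X : MetricSpace) : Prop :=
  forall x y : X, exists gamma, geodesic X gamma x y.

(** * The model surface M^2_kappa, kappa <= 0
    kappa < 0 : hyperboloid model {p0^2 - p1^2 - p2^2 = 1, p0 > 0} in R^3 with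
                distance arcosh(p0 q0 - p1 q1 - p2 q2) / sqrt(-kappa);
    kappa >= 0 (used only for kappa = 0) : Euclidean plane {p0 = 0}. *)
Record Mpt := mkM { m0 : R; m1 : R; m2 : R }.

Definition arcosh (x : R) : R := ln (x + sqrt (x * x - 1)).

Definition in_model (kappa : R) (p : Mpt) : Prop :=
  if Rlt_dec kappa 0
  then m0 p * m0 p - m1 p * m1 p - m2 p * m2 p = 1 /\ 0 < m0 p
  else m0 p = 0.

Definition distM (kappa : R) (p q : Mpt) : R :=
  if Rlt_dec kappa 0
  then / sqrt (- kappa) * arcosh (m0 p * m0 q - m1 p * m1 q - m2 p * m2 q)
  else sqrt ((m1 p - m1 q) ^ 2 + (m2 p - m2 q) ^ 2).

(** xb is the comparison point in M^2_kappa, on the side [pb,qb] of the comparison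
    triangle, of the point gamma t on the geodesic side gamma from p to q. *)
Definition side_point (kappa : R) (X : MetricSpace) (gamma : R -> X) (p q : X)
    (pb qb : Mpt) (x : X) (xb : Mpt) : Prop :=
  exists t, 0 <= t <= dist p q /\ x = gamma t /\ in_model kappa xb /\
    distM kappa pb xb = t /\ distM kappa xb qb = dist p q - t.

Definition triangle_comparison (kappa : R) (X : MetricSpace) (rel : R -> R -> Prop) : Prop :=
  forall (p q r : X) (g1 g2 g3 : R -> X),
    geodesic X g1 p q -> geodesic X g2 q r -> geodesic X g3 r p ->
    forall pb qb rb : Mpt,
      in_model kappa pb -> in_model kappa qb -> in_model kappa rb ->
      distM kappa pb qb = dist p q -> distM kappa qb rb = dist q r ->
      distM kappa rb pb = dist r p ->
      let on_tri := fun (x : X) (xb : Mpt) =>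
        side_point kappa X g1 p q pb qb x xb \/
        side_point kappa X g2 q r qb rb x xb \/
        side_point kappa X g3 r p rb pb x xb in
      forall x xb y yb, on_tri x xb -> on_tri y yb ->
        rel (dist x y) (distM kappa xb yb).

Definition CAT (kappa : R) (X : MetricSpace) : Prop :=
  geodesic_space X /\ triangle_comparison kappa X Rle.

Definition CBB (kappa : R) (X : MetricSpace) : Prop :=
  geodesic_space X /\ triangle_comparison kappa X Rge.

Definition nonexpansive (M Y : MetricSpace) (f : M -> Y) : Prop :=
  forall a b, dist (f a) (f b) <= dist a b.

Definition bounded_map (M Y : MetricSpace) (f : M -> Y) : Prop :=
  exists B, forall a b, dist (f a) (f b) <= B.

Definition NE (M Y : MetricSpace) : Type :=
  {f : M -> Y | nonexpansive M Y f /\ bounded_map M Y f}.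

Definition supdist (M Y : MetricSpace) (f g : M -> Y) : Rbar :=
  Lub_Rbar (fun r => exists a, r = dist (f a) (g a)).

Definition NE_continuous (M1 Y1 M2 Y2 : MetricSpace)
    (F : NE M1 Y1 -> NE M2 Y2) : Prop :=
  forall g eps, 0 < eps -> exists delta, 0 < delta /\
    forall h, Rbar_lt (supdist M1 Y1 (proj1_sig g) (proj1_sig h)) (Finite delta) ->
      Rbar_lt (supdist M2 Y2 (proj1_sig (F g)) (proj1_sig (F h))) (Finite eps).

Definition G1 (Y : MetricSpace) (C : Y -> Prop) : Y -> Prop :=
  fun y => exists c1 c2 gamma t, C c1 /\ C c2 /\ geodesic Y gamma c1 c2 /\
    0 <= t <= dist c1 c2 /\ y = gamma t.

Fixpoint Gn (Y : MetricSpace) (n : nat) (C : Y -> Prop) : Y -> Prop :=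
  match n with
  | O => C
  | S k => G1 Y (Gn Y k C)
  end.

Definition co (Y : MetricSpace) (C : Y -> Prop) : Y -> Prop :=
  fun y => exists n, (1 <= n)%nat /\ Gn Y n C y.

Definition closure (Y : MetricSpace) (C : Y -> Prop) : Y -> Prop :=
  fun y => forall eps, 0 < eps -> exists z, C z /\ dist y z < eps.

Definition closed_co (Y : MetricSpace) (C : Y -> Prop) : Y -> Prop :=
  closure Y (co Y C).

(* Main.v *)
(* For kappa = - k^2 write md for the function with f'' = 1 + k^2 f, f(0) = f'(0) = 0, so that
   md(d(., p)) satisfies this equation, with <= for CBB and >= for CAT, along geodesics.

   Put on N(A,Y) a pseudometric T, continuous for the supremum metric, such that
   md(d(g a, h b)) <= md(d(a, b)) + T(g, h). All maps g are then extended at once: the map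
   (g, a) |-> g a extends to F on N(A,Y) x X subject to the same inequality, so each F g is
   nonexpansive and F depends continuously on g, uniformly on X. Composing F g with the nearest
   point projection onto the closed convex hull of g(A) gives alpha_c(g).

   By Zorn's lemma F is extended point by point, as in the Lang-Schroeder theorem. The balls
   that have to meet in Y do meet as soon as all sums over i, j in a finite list of
   md_i + md_j + k^2 md_i md_j - md_ij are nonnegative. For points of X this is the
   Lang-Schroeder-Sturm inequality in CBB(kappa); adding T only increases the summands, by the
   triangle inequality for T. *)
From Stdlib Require Import Reals Lra Lia List ClassicalEpsilon.
From Coquelicot Require Import Coquelicot.
From mathcomp Require classical_sets.
Require Import Defs.
Import ListNotations.
Open Scope R_scope.

(** * Hyperbolic functions *)


(** Zorn's lemma gives no control over the values it picks, so extending each map separately could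
    not yield continuity; once all maps form a single one, continuity is part of the inequality that
    the extension preserves. The error [T] is added to [md], not to the distance, because the
    criterion for balls to meet is a sum with nonnegative weights in which the values of [md] occur
    with known signs: an additive error can be followed through it entry by entry. Lying in the hull
    of [g(A)] is not an inequality of this kind, hence the projection at the end.

    Angles and tangent cones are avoided. Each curvature bound is reduced to the effect of one short
    step on [md] of the distance to an arbitrary point ([expanding_steps], [contracting_steps]). The
    first gives the Lang-Schroeder-Sturm inequality by a maximisation in [X]; the second gives the
    intersection of finitely many balls by averaging over a walk in [Y]. [X] carries no compactness,
    so only almost maximal points exist and errors of order [t ^ 2] have to be tracked. *)

Lemma nondecreasing_of_derive (f df : R -> R) (a b : R) :
  a <= b -> (forall x, a <= x <= b -> is_derive f x (df x)) ->
  (forall x, a <= x <= b -> 0 <= df x) -> f a <= f b.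
Proof.
  intros hab hd hp.
  destruct (MVT_gen f a b df) as [c [hc e]].
  - intros x hx. rewrite Rmin_left, Rmax_right in hx by lra. apply hd; lra.
  - intros x hx. rewrite Rmin_left, Rmax_right in hx by lra.
    apply derivable_continuous_pt. exists (df x). apply is_derive_Reals, hd; lra.
  - rewrite Rmin_left, Rmax_right in hc by lra.
    pose proof (hp c hc). nra.
Qed.

Lemma cosh_plus (x y : R) : cosh (x + y) = cosh x * cosh y + sinh x * sinh y.
Proof.
  unfold cosh, sinh. rewrite Ropp_plus_distr, !exp_plus. field.
Qed.

Lemma sinh_plus (x y : R) : sinh (x + y) = sinh x * cosh y + cosh x * sinh y.
Proof.
  unfold cosh, sinh. rewrite Ropp_plus_distr, !exp_plus. field.
Qed.

Lemma cosh_opp (x : R) : cosh (- x) = cosh x.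
Proof. unfold cosh. rewrite Ropp_involutive. lra. Qed.

Lemma sinh_opp (x : R) : sinh (- x) = - sinh x.
Proof. unfold sinh. rewrite Ropp_involutive. lra. Qed.

Lemma cosh_sq (x : R) : cosh x * cosh x = 1 + sinh x * sinh x.
Proof.
  pose proof (cosh_plus x (- x)) as h.
  rewrite cosh_opp, sinh_opp, Rplus_opp_r, cosh_0 in h. lra.
Qed.

Lemma cosh_ge_1 (x : R) : 1 <= cosh x.
Proof.
  pose proof (cosh_sq x).
  assert (0 < cosh x)
    by (unfold cosh; pose proof (exp_pos x); pose proof (exp_pos (- x)); lra).
  nra.
Qed.

Lemma sinh_le (x y : R) : x <= y -> sinh x <= sinh y.
Proof.
  intros [h | ->]; [left; now apply sinh_lt | lra].
Qed.

Lemma sinh_nonneg (x : R) : 0 <= x -> 0 <= sinh x.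
Proof. intros h. rewrite <- sinh_0. now apply sinh_le. Qed.

Lemma sinh_pos (x : R) : 0 < x -> 0 < sinh x.
Proof. intros h. rewrite <- sinh_0. now apply sinh_lt. Qed.

Lemma cosh_le (x y : R) : 0 <= x <= y -> cosh x <= cosh y.
Proof.
  intros h. pose proof (cosh_sq x). pose proof (cosh_sq y).
  pose proof (cosh_ge_1 x). pose proof (cosh_ge_1 y).
  pose proof (sinh_le x y ltac:(lra)). pose proof (sinh_nonneg x ltac:(lra)).
  nra.
Qed.

Lemma cosh_lt (x y : R) : 0 <= x < y -> cosh x < cosh y.
Proof.
  intros h. pose proof (cosh_sq x). pose proof (cosh_sq y).
  pose proof (cosh_ge_1 x). pose proof (cosh_ge_1 y).
  pose proof (sinh_lt x y ltac:(lra)). pose proof (sinh_nonneg x ltac:(lra)).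
  nra.
Qed.

Lemma sinh_scale (t x : R) : 0 <= t <= 1 -> 0 <= x -> sinh (t * x) <= t * sinh x.
Proof.
  intros ht hx.
  assert (h := nondecreasing_of_derive (fun x => t * sinh x - sinh (t * x))
    (fun x => t * (cosh x - cosh (t * x))) 0 x hx).
  cbv beta in h. rewrite Rmult_0_r, sinh_0 in h.
  enough (t * 0 - 0 <= t * sinh x - sinh (t * x)) by lra. apply h.
    - intros y _. auto_derive; auto. ring.
    - intros y hy. apply Rmult_le_pos; [lra |].
      pose proof (cosh_le (t * y) y ltac:(split; nra)). lra.
Qed.

Lemma sinh_ge_id (x : R) : 0 <= x -> x <= sinh x.
Proof.
  intros hx.
  assert (h := nondecreasing_of_derive (fun x => sinh x - x) (fun x => cosh x - 1) 0 x hx).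
  cbv beta in h. rewrite sinh_0 in h.
  enough (0 - 0 <= sinh x - x) by lra. apply h.
    - intros y _. auto_derive; auto. ring.
    - intros y _. pose proof (cosh_ge_1 y). lra.
Qed.

Lemma cosh_half (x : R) : cosh x - 1 = 2 * (sinh (x / 2) * sinh (x / 2)).
Proof.
  replace x with (x / 2 + x / 2) at 1 by field.
  rewrite cosh_plus. pose proof (cosh_sq (x / 2)). lra.
Qed.

(** * The comparison function *)

(* [md k] solves [f'' = 1 + k^2 f], [f 0 = f' 0 = 0]; composed with the distance to a
   fixed point, it satisfies this equation along the geodesics of the model surface of
   curvature [- k^2]. *)
Definition md (k x : R) : R :=
  if Req_EM_T k 0 then x ^ 2 / 2 else (cosh (k * x) - 1) / k ^ 2.

Lemma md_0 (k : R) : md k 0 = 0.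
Proof.
  unfold md. destruct (Req_EM_T k 0). lra. rewrite Rmult_0_r, cosh_0. field; auto.
Qed.

Lemma md_ge_sqr (k x : R) : 0 <= k -> 0 <= x -> x ^ 2 / 2 <= md k x.
Proof.
  intros hk hx. unfold md. destruct (Req_EM_T k 0) as [_ | hk0]; [lra |].
  rewrite cosh_half.
  pose proof (sinh_ge_id (k * x / 2) ltac:(nra)) as h.
  apply Rmult_le_reg_r with (k ^ 2); [nra |].
  unfold Rdiv at 2. rewrite Rmult_assoc, Rinv_l by (apply pow_nonzero; auto).
  assert (h0 : 0 <= k * x / 2) by nra.
  pose proof (Rmult_le_compat _ _ _ _ h0 h0 h h). nra.
Qed.

Lemma md_nonneg (k x : R) : 0 <= k -> 0 <= x -> 0 <= md k x.
Proof. intros hk hx. pose proof (md_ge_sqr k x hk hx). nra. Qed.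

Lemma md_lt (k x y : R) : 0 <= k -> 0 <= x < y -> md k x < md k y.
Proof.
  intros hk hx. unfold md. destruct (Req_EM_T k 0) as [_ | hk0]; [nra |].
  apply Rmult_lt_compat_r; [apply Rinv_0_lt_compat; nra |].
  pose proof (cosh_lt (k * x) (k * y) ltac:(split; nra)). lra.
Qed.

Lemma md_le (k x y : R) : 0 <= k -> 0 <= x <= y -> md k x <= md k y.
Proof.
  intros hk [hx [h | ->]]; [left; apply md_lt; lra | lra].
Qed.

Lemma md_le_inv (k x y : R) : 0 <= k -> 0 <= y -> md k x <= md k y -> x <= y.
Proof.
  intros hk hy h. destruct (Rle_or_lt x y) as [|l]; auto.
  pose proof (md_lt k y x hk ltac:(lra)). lra.
Qed.

(** True even with [l ^ 2] for [l]: when [k <> 0], [md k x] is a multiple of the square of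
    [sinh (k * x / 2)]. It serves to turn a bound between values of [md] back into one between
    distances. *)
Lemma md_scale (k l x : R) : 0 <= k -> 1 <= l -> 0 <= x -> l * md k x <= md k (l * x).
Proof.
  intros hk hl hx.
  enough (l ^ 2 * md k x <= md k (l * x)) 
    by (pose proof (md_nonneg k x hk hx); assert (0 <= (l - 1) * (l * md k x)) by
      (repeat apply Rmult_le_pos; lra); nra).
  unfold md. destruct (Req_EM_T k 0) as [_ | hk0]; [nra |].
  rewrite !cosh_half.
  assert (h : sinh (/ l * (k * (l * x) / 2)) <= / l * sinh (k * (l * x) / 2)).
  { apply sinh_scale. split. left; apply Rinv_0_lt_compat; lra.
    rewrite <- Rinv_1. apply Rinv_le_contravar; lra.
    assert (0 <= k * (l * x)) by (apply Rmult_le_pos; nra). lra. }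
  replace (/ l * (k * (l * x) / 2)) with (k * x / 2) in h by (field; lra).
  set (A := sinh (k * x / 2)) in *. set (B := sinh (k * (l * x) / 2)) in *.
  assert (0 <= A) by (apply sinh_nonneg; nra).
  assert (h' : l * A <= B).
  { apply Rmult_le_reg_l with (/ l). apply Rinv_0_lt_compat; lra.
    rewrite <- Rmult_assoc, Rinv_l by lra. lra. }
  unfold Rdiv. rewrite <- Rmult_assoc. apply Rmult_le_compat_r.
  left; apply Rinv_0_lt_compat; nra.
  assert (0 <= l * A) by nra.
  pose proof (Rmult_le_compat _ _ _ _ H0 H0 h' h'). nra.
Qed.

Lemma md_lipschitz (k B : R) : 0 <= k -> 0 <= B ->
  exists G, 0 < G /\ forall x y, 0 <= x <= B -> 0 <= y <= B ->
    Rabs (md k x - md k y) <= G * Rabs (x - y).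
Proof.
  intros hk hB. unfold md. destruct (Req_EM_T k 0) as [_ | hk0].
  - exists (B + 1). split; [lra |]. intros x y hx hy.
    replace (x ^ 2 / 2 - y ^ 2 / 2) with ((x + y) / 2 * (x - y)) by field.
    rewrite Rabs_mult. apply Rmult_le_compat_r. apply Rabs_pos.
    rewrite Rabs_pos_eq; lra.
  - exists (sinh (k * B) / k + 1).
    assert (h0 : 0 <= sinh (k * B) / k).
    { apply Rmult_le_pos. apply sinh_nonneg; nra. left; apply Rinv_0_lt_compat; lra. }
    split; [lra |]. intros x y hx hy.
    destruct (MVT_gen (fun x => (cosh (k * x) - 1) / k ^ 2) y x
                (fun x => sinh (k * x) / k)) as [c [hc e]].
    + intros z _. auto_derive; auto. field; auto.
    + intros z _. apply derivable_continuous_pt. exists (sinh (k * z) / k).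
      apply is_derive_Reals. auto_derive; auto. field; auto.
    + rewrite e, Rabs_mult. apply Rmult_le_compat_r. apply Rabs_pos.
      assert (hc' : 0 <= c <= B).
      { split. apply Rle_trans with (Rmin y x); [apply Rmin_glb; lra | lra].
        apply Rle_trans with (Rmax y x); [lra | apply Rmax_lub; lra]. }
      assert (0 <= sinh (k * c)) by (apply sinh_nonneg; nra).
      assert (sinh (k * c) <= sinh (k * B)) by (apply sinh_le; nra).
      assert (0 < / k) by (apply Rinv_0_lt_compat; lra).
      unfold Rdiv in *. rewrite Rabs_pos_eq; nra.
Qed.

(** * Comparison along a geodesic *)


Lemma arcosh_cosh (x : R) : 0 <= x -> arcosh (cosh x) = x.
Proof.
  intros hx. unfold arcosh.
  replace (cosh x * cosh x - 1) with (sinh x * sinh x) by (pose proof (cosh_sq x); lra).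
  rewrite sqrt_square by (now apply sinh_nonneg).
  replace (cosh x + sinh x) with (exp x) by (unfold cosh, sinh; field).
  apply ln_exp.
Qed.

Lemma cosh_surj (x : R) : 1 <= x -> exists y, 0 <= y /\ cosh y = x.
Proof.
  intros hx. exists (arcsinh (sqrt (x * x - 1))).
  assert (h : 0 <= arcsinh (sqrt (x * x - 1))).
  { rewrite <- arcsinh_0. apply arcsinh_le, sqrt_pos. }
  split; auto.
  pose proof (cosh_sq (arcsinh (sqrt (x * x - 1)))) as e.
  rewrite sinh_arcsinh, sqrt_sqrt in e by nra.
  pose proof (cosh_ge_1 (arcsinh (sqrt (x * x - 1)))). nra.
Qed.

Lemma dist_refl (Z : MetricSpace) (x : Z) : dist x x = 0.
Proof. now apply dist_eq0. Qed.

Lemma dist_nonneg (Z : MetricSpace) (x y : Z) : 0 <= dist x y.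
Proof.
  pose proof (dist_tri Z x y x) as h. rewrite dist_refl, (dist_sym Z y x) in h. lra.
Qed.

(* [D] is the distance, in the model surface of curvature [- k^2], from the vertex [r] of a
   triangle [pqr] with [pq = L], [pr = b], [qr = c] to the point of [pq] at distance [s]
   from [p]. *)
Definition model_cevian (k L s b c D : R) : Prop :=
  if Req_EM_T k 0
  then D ^ 2 = ((L - s) * b ^ 2 + s * c ^ 2) / L - s * (L - s)
  else cosh (k * D) = (sinh (k * (L - s)) * cosh (k * b) + sinh (k * s) * cosh (k * c))
                        / sinh (k * L).

Lemma sqrt_opp_pos (kappa : R) : kappa < 0 -> 0 < sqrt (- kappa).
Proof. intros h. apply sqrt_lt_R0. lra. Qed.

(** Coordinates with [p] at the origin and [q] on an axis: [X] comes from the law of cosines, [Y] is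
    real by Heron's factorisation, and the formula for [D] is Stewart's theorem. The trivial
    distance from [rb] to itself is recorded because the vertex will be presented as a point of a
    side. *)
Lemma euclidean_cevian (L s b c : R) :
  0 < L -> 0 <= s <= L -> 0 <= b -> 0 <= c -> b <= L + c -> c <= L + b -> L <= b + c ->
  exists (pb qb rb xb : Mpt) (D : R),
    in_model 0 pb /\ in_model 0 qb /\ in_model 0 rb /\ in_model 0 xb /\
    distM 0 pb qb = L /\ distM 0 qb rb = c /\ distM 0 rb pb = b /\ distM 0 rb rb = 0 /\
    distM 0 pb xb = s /\ distM 0 xb qb = L - s /\ distM 0 xb rb = D /\
    0 <= D /\ D ^ 2 = ((L - s) * b ^ 2 + s * c ^ 2) / L - s * (L - s).
Proof.
  intros hL hs hb hc h1 h2 h3.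
  set (X := (b ^ 2 + L ^ 2 - c ^ 2) / (2 * L)).
  assert (hX : 2 * L * X = b ^ 2 + L ^ 2 - c ^ 2) by (unfold X; field; lra).
  assert (hY : 0 <= b ^ 2 - X ^ 2).
  { assert (0 <= (2 * L) ^ 2 * (b ^ 2 - X ^ 2)).
    { replace ((2 * L) ^ 2 * (b ^ 2 - X ^ 2))
        with ((2 * L * b) ^ 2 - (2 * L * X) ^ 2) by ring.
      rewrite hX.
      replace ((2 * L * b) ^ 2 - (b ^ 2 + L ^ 2 - c ^ 2) ^ 2)
        with (((b + L + c) * (b + L - c)) * ((c + L - b) * (c + b - L))) by ring.
      repeat apply Rmult_le_pos; lra. }
    assert (0 < (2 * L) ^ 2) by nra. nra. }
  set (Y := sqrt (b ^ 2 - X ^ 2)).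
  assert (eY : Y * Y = b ^ 2 - X ^ 2) by (now apply sqrt_sqrt).
  assert (key : forall u v w, 0 <= w -> u ^ 2 + v ^ 2 = w ^ 2 -> sqrt (u ^ 2 + v ^ 2) = w).
  { intros u v w hw ->. rewrite <- Rsqr_pow2. now apply sqrt_Rsqr. }
  exists (mkM 0 0 0), (mkM 0 L 0), (mkM 0 X Y), (mkM 0 s 0), (sqrt ((s - X) ^ 2 + (0 - Y) ^ 2)).
  unfold in_model, distM. destruct (Rlt_dec 0 0) as [l | _]; [lra |]. simpl m0; simpl m1; simpl m2.
  repeat (split; [first [reflexivity | apply key; [lra | lra] | apply sqrt_pos] |]).
  rewrite pow2_sqrt by (pose proof (pow2_ge_0 (s - X)); pose proof (pow2_ge_0 (0 - Y)); lra).
  apply Rmult_eq_reg_r with L; [| lra].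
  replace ((((L - s) * b ^ 2 + s * c ^ 2) / L - s * (L - s)) * L)
    with (L * b ^ 2 - s * (b ^ 2 + L ^ 2 - c ^ 2) + s ^ 2 * L) by (field; lra).
  rewrite <- hX. replace ((0 - Y) ^ 2) with (Y * Y) by ring. rewrite eY. ring.
Qed.

Lemma distM_hyperbolic (kappa : R) (p q : Mpt) (d : R) :
  kappa < 0 -> 0 <= d ->
  m0 p * m0 q - m1 p * m1 q - m2 p * m2 q = cosh (sqrt (- kappa) * d) ->
  distM kappa p q = d.
Proof.
  intros hk hd e. pose proof (sqrt_opp_pos kappa hk).
  unfold distM. destruct (Rlt_dec kappa 0); [| lra].
  rewrite e, arcosh_cosh by nra. field. lra.
Qed.

(** On the hyperboloid with [p] at the apex, [X] is forced by the distance from [r] to [q]; the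
    triangle inequalities amount to [X ^ 2 <= sinh (k * b) ^ 2], which leaves a real [Y]. *)
Lemma hyperbolic_cevian (kappa L s b c : R) :
  kappa < 0 ->
  0 < L -> 0 <= s <= L -> 0 <= b -> 0 <= c -> b <= L + c -> c <= L + b -> L <= b + c ->
  exists (pb qb rb xb : Mpt) (D : R),
    in_model kappa pb /\ in_model kappa qb /\ in_model kappa rb /\ in_model kappa xb /\
    distM kappa pb qb = L /\ distM kappa qb rb = c /\ distM kappa rb pb = b /\
    distM kappa rb rb = 0 /\ distM kappa pb xb = s /\ distM kappa xb qb = L - s /\
    distM kappa xb rb = D /\ 0 <= D /\
    let k := sqrt (- kappa) in
    cosh (k * D) = (sinh (k * (L - s)) * cosh (k * b) + sinh (k * s) * cosh (k * c))
                     / sinh (k * L).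
Proof.
  intros hk hL hs hb hc h1 h2 h3. cbv zeta.
  pose proof (sqrt_opp_pos kappa hk) as hk0. set (k := sqrt (- kappa)) in *.
  assert (hS : 0 < sinh (k * L)) by (apply sinh_pos; nra).
  set (X := (cosh (k * b) * cosh (k * L) - cosh (k * c)) / sinh (k * L)).
  assert (hX : X * sinh (k * L) = cosh (k * b) * cosh (k * L) - cosh (k * c))
    by (unfold X; field; lra).
  assert (hY : 0 <= sinh (k * b) * sinh (k * b) - X * X).
  { set (B := sinh (k * b)) in *.
    assert (hB : 0 <= B) by (apply sinh_nonneg; nra).
    assert (u1 : cosh (k * c) <= cosh (k * b) * cosh (k * L) + B * sinh (k * L)).
    { unfold B. rewrite <- cosh_plus. apply cosh_le. nra. }
    assert (u2 : cosh (k * b) * cosh (k * L) - B * sinh (k * L) <= cosh (k * c)).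
    { replace (cosh (k * b) * cosh (k * L) - B * sinh (k * L))
        with (cosh (k * b + - (k * L))) by (rewrite cosh_plus, cosh_opp, sinh_opp; unfold B; ring).
      destruct (Rle_or_lt b L).
      - rewrite <- cosh_opp. apply cosh_le. nra.
      - apply cosh_le. nra. }
    assert (u3 : - B * sinh (k * L) <= X * sinh (k * L) <= B * sinh (k * L)) by lra.
    assert (- B <= X) by (apply Rmult_le_reg_r with (sinh (k * L)); lra).
    assert (X <= B) by (apply Rmult_le_reg_r with (sinh (k * L)); lra).
    nra. }
  set (Y := sqrt (sinh (k * b) * sinh (k * b) - X * X)).
  assert (eY : Y * Y = sinh (k * b) * sinh (k * b) - X * X) by (now apply sqrt_sqrt).
  (* The bilinear form of the model evaluated at [r] and the foot of the cevian, that is, [cosh] of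
     [k] times their distance. *)
  set (E := cosh (k * s) * cosh (k * b) - sinh (k * s) * X).
  assert (eE : E = (sinh (k * (L - s)) * cosh (k * b) + sinh (k * s) * cosh (k * c))
                     / sinh (k * L)).
  { apply Rmult_eq_reg_r with (sinh (k * L)); [| lra].
    unfold Rdiv. rewrite Rmult_assoc, Rinv_l, Rmult_1_r by lra.
    unfold E. rewrite Rmult_minus_distr_r, Rmult_assoc, (Rmult_assoc (sinh (k * s))), hX.
    replace (k * (L - s)) with (k * L + - (k * s)) by ring.
    rewrite sinh_plus, cosh_opp, sinh_opp. ring. }
  assert (hE : 1 <= E).
  { pose proof (cosh_sq (k * s)). pose proof (cosh_sq (k * b)).
    pose proof (cosh_ge_1 (k * s)). pose proof (cosh_ge_1 (k * b)).
    assert (0 <= sinh (k * s)) by (apply sinh_nonneg; nra).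
    assert (0 <= sinh (k * b)) by (apply sinh_nonneg; nra).
    assert (X <= sinh (k * b)) by nra.
    assert (cosh (k * s + - (k * b)) <= E).
    { rewrite cosh_plus, cosh_opp, sinh_opp. unfold E. nra. }
    pose proof (cosh_ge_1 (k * s + - (k * b))). lra. }
  destruct (cosh_surj E hE) as [D [hD eD]].
  exists (mkM 1 0 0), (mkM (cosh (k * L)) (sinh (k * L)) 0), (mkM (cosh (k * b)) X Y),
    (mkM (cosh (k * s)) (sinh (k * s)) 0), (D / k).
  assert (hDk : 0 <= D / k) by (apply Rmult_le_pos; [auto | left; now apply Rinv_0_lt_compat]).
  assert (eDk : k * (D / k) = D) by (field; lra).
  pose proof (cosh_sq (k * L)). pose proof (cosh_sq (k * b)). pose proof (cosh_sq (k * s)).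
  pose proof (cosh_ge_1 (k * L)). pose proof (cosh_ge_1 (k * b)). pose proof (cosh_ge_1 (k * s)).
  unfold in_model. destruct (Rlt_dec kappa 0) as [_ |]; [| lra].
  repeat match goal with
  | |- _ /\ _ => split
  | |- distM _ _ _ = _ => apply distM_hyperbolic; [lra | lra |]; fold k
  end; simpl m0; simpl m1; simpl m2; try lra.
  - rewrite Rmult_0_r, cosh_0. lra.
  - replace (k * (L - s)) with (k * L + - (k * s)) by ring.
    rewrite cosh_plus, cosh_opp, sinh_opp. ring.
  - rewrite eDk, eD. unfold E. ring.
  - rewrite eDk, eD. exact eE.
Qed.

(** The only use of triangle comparison is between a vertex and a point of the opposite side; [rel]
    lets CAT and CBB share it. The vertex [z] is the point of the side [q z] with parameter
    [dist q z]. *)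
Lemma comparison_cevian (kappa : R) (Z : MetricSpace) (rel : R -> R -> Prop)
  (g : R -> Z) (p q z : Z) (s : R) :
  kappa <= 0 -> geodesic_space Z -> triangle_comparison kappa Z rel ->
  geodesic Z g p q -> 0 < dist p q -> 0 <= s <= dist p q ->
  exists D, 0 <= D /\ rel (dist (g s) z) D /\
    model_cevian (sqrt (- kappa)) (dist p q) s (dist p z) (dist q z) D.
Proof.
  intros hk hg hZ hgeo hL hs.
  destruct (hg q z) as [g2 hg2]. destruct (hg z p) as [g3 hg3].
  assert (tri : exists (pb qb rb xb : Mpt) (D : R),
    in_model kappa pb /\ in_model kappa qb /\ in_model kappa rb /\ in_model kappa xb /\
    distM kappa pb qb = dist p q /\ distM kappa qb rb = dist q z /\
    distM kappa rb pb = dist p z /\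
    distM kappa rb rb = 0 /\ distM kappa pb xb = s /\ distM kappa xb qb = dist p q - s /\
    distM kappa xb rb = D /\ 0 <= D /\
    model_cevian (sqrt (- kappa)) (dist p q) s (dist p z) (dist q z) D).
  { pose proof (dist_nonneg Z p z). pose proof (dist_nonneg Z q z).
    pose proof (dist_tri Z p q z). pose proof (dist_tri Z q p z) as t2.
    pose proof (dist_tri Z p z q) as t3.
    rewrite (dist_sym Z q p) in t2. rewrite (dist_sym Z z q) in t3.
    unfold model_cevian. destruct hk as [hk | ->].
    - destruct (Req_EM_T (sqrt (- kappa)) 0) as [e |].
      + pose proof (sqrt_opp_pos kappa hk). lra.
      + apply hyperbolic_cevian; lra.
    - rewrite Ropp_0, sqrt_0. destruct (Req_EM_T 0 0) as [_ | n]; [| now destruct n].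
      apply euclidean_cevian; lra. }
  destruct tri as (pb & qb & rb & xb & D & ip & iq & ir & ix & dpq & dqr & drp & drr & dpx
                     & dxq & dxr & hD & hm).
  exists D. split; [auto | split; [| auto]].
  rewrite <- dxr.
  rewrite (dist_sym Z p z) in drp.
  apply (hZ p q z g g2 g3 hgeo hg2 hg3 pb qb rb ip iq ir dpq dqr drp).
  - left. exists s. repeat (split; auto); tauto.
  - right; left. exists (dist q z). pose proof (dist_nonneg Z q z).
    split; [lra | split; [symmetry; apply hg2 |]]. repeat (split; auto); lra.
Qed.

(** The generalised sine, which is the derivative of [md k]. *)
Definition sn (k x : R) : R := if Req_EM_T k 0 then x else sinh (k * x) / k.

Lemma sn_nonneg (k x : R) : 0 <= k -> 0 <= x -> 0 <= sn k x.
Proof.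
  intros hk hx. unfold sn. destruct (Req_EM_T k 0); auto.
  apply Rmult_le_pos. apply sinh_nonneg; nra. left; apply Rinv_0_lt_compat; lra.
Qed.

Lemma sn_le (k x y : R) : 0 <= k -> 0 <= x <= y -> sn k x <= sn k y.
Proof.
  intros hk hx. unfold sn. destruct (Req_EM_T k 0); [lra |].
  apply Rmult_le_compat_r. left; apply Rinv_0_lt_compat; lra.
  apply sinh_le; nra.
Qed.

(* The foot of the cevian is chosen so that the weight of [c] is exactly [t]. *)
Lemma md_cevian (k L t : R) : 0 <= k -> 0 < L -> 0 <= t <= 1 ->
  exists s a e,
    0 <= s <= L /\ t * L <= s <= t * sn k L /\ 0 <= a /\ a + t <= 1 /\ 0 <= e /\
    1 - t * (1 + k ^ 2 * md k L) <= a /\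
    a <= 1 - t * (1 + k ^ 2 * md k L) + k ^ 2 * (t ^ 2 * (sn k L ^ 2 / 2)) /\
    t * md k L - t ^ 2 * (sn k L ^ 2 / 2) <= e <= t * md k L /\
    forall b c D, model_cevian k L s b c D -> md k D = a * md k b + t * md k c - e.
Proof.
  intros hk hL ht. unfold md, sn, model_cevian.
  destruct (Req_EM_T k 0) as [-> | hk0].
  - exists (t * L), (1 - t), (t * (1 - t) * (L ^ 2 / 2)).
    assert (0 <= L ^ 2) by nra. assert (0 <= t * (1 - t)) by nra.
    repeat split; try nra.
    intros b c D h. rewrite h. field. lra.
  - set (S := sinh (k * L)).
    assert (hS : 0 < S) by (apply sinh_pos; nra).
    (* [u / k] is the position [s] of the foot, so that [sinh (k * s) / sinh (k * L) = t]. Writing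
       [cosh] as [1 + k ^ 2 * md] in the cevian formula produces [e = (1 - a - t) / k ^ 2], and
       [1 <= cosh u <= 1 + t ^ 2 * S ^ 2 / 2] gives all bounds on [a] and [e]. *)
    set (u := arcsinh (t * S)).
    assert (eu : sinh u = t * S) by (apply sinh_arcsinh).
    assert (hu : 0 <= u) by (unfold u; rewrite <- arcsinh_0; apply arcsinh_le; nra).
    assert (huL : u <= k * L).
    { unfold u. rewrite <- (arcsinh_sinh (k * L)). apply arcsinh_le. fold S. nra. }
    assert (hut : t * (k * L) <= u).
    { unfold u. rewrite <- (arcsinh_sinh (t * (k * L))). apply arcsinh_le.
      apply sinh_scale; nra. }
    assert (hus : u <= t * S) by (rewrite <- eu; now apply sinh_ge_id).
    set (a := cosh u - t * cosh (k * L)).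
    assert (ea : a * S = sinh (k * L + - u)).
    { rewrite sinh_plus, cosh_opp, sinh_opp, eu. unfold a. fold S. ring. }
    assert (hik : 0 < / k) by (apply Rinv_0_lt_compat; lra).
    assert (hik2 : 0 < / k ^ 2) by (apply Rinv_0_lt_compat; nra).
    assert (eik : k * / k = 1) by (field; auto).
    assert (ha : 0 <= a).
    { assert (0 <= sinh (k * L + - u)) by (apply sinh_nonneg; lra). nra. }
    (* The foot cuts [k * L] into two parts; convexity of [sinh] bounds [t * S] and [a * S] by the
       proportions [w] and [1 - w] of [S]. *)
    assert (hat : a + t <= 1).
    { set (w := u / (k * L)).
      assert (hkL : 0 < k * L) by nra.
      assert (ew : w * (k * L) = u) by (unfold w; field; nra).
      assert (hw : 0 <= w <= 1) by (split; nra).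
      pose proof (sinh_scale w (k * L) hw ltac:(lra)) as b1.
      pose proof (sinh_scale (1 - w) (k * L) ltac:(lra) ltac:(lra)) as b2.
      replace ((1 - w) * (k * L)) with (k * L + - u) in b2 by lra.
      rewrite ew, eu in b1. fold S in b1, b2. rewrite <- ea in b2.
      apply Rmult_le_reg_r with S; lra. }
    pose proof (cosh_ge_1 u) as hcu. pose proof (cosh_sq u) as ecu. rewrite eu in ecu.
    assert (hcu2 : cosh u <= 1 + t ^ 2 * S ^ 2 / 2).
    { assert (0 <= (t ^ 2 * S ^ 2 / 2) ^ 2) by apply pow2_ge_0. nra. }
    exists (u / k), a, ((1 - a - t) / k ^ 2).
    replace (1 + k ^ 2 * ((cosh (k * L) - 1) / k ^ 2)) with (cosh (k * L)) by (field; auto).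
    replace (k ^ 2 * (t ^ 2 * ((S / k) ^ 2 / 2))) with (t ^ 2 * S ^ 2 / 2) by (field; auto).
    replace (t ^ 2 * ((S / k) ^ 2 / 2)) with ((t ^ 2 * S ^ 2 / 2) / k ^ 2) by (field; auto).
    unfold Rdiv at 1 2 3 4.
    repeat split.
    + nra.
    + apply Rmult_le_reg_l with k; [lra |]. replace (k * (u * / k)) with u by (field; auto). lra.
    + apply Rmult_le_reg_l with k; [lra |]. replace (k * (u * / k)) with u by (field; auto). lra.
    + unfold Rdiv. rewrite <- Rmult_assoc. apply Rmult_le_compat_r; lra.
    + auto.
    + auto.
    + apply Rmult_le_pos; lra.
    + unfold a. lra.
    + unfold a. lra.
    + unfold Rdiv. rewrite <- Rmult_assoc, <- Rmult_minus_distr_r.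
      apply Rmult_le_compat_r; [lra |]. unfold a. lra.
    + unfold Rdiv. rewrite <- Rmult_assoc.
      apply Rmult_le_compat_r; [lra |]. unfold a. lra.
    + intros b c D h. rewrite h. replace (k * (u / k)) with u by (field; auto). rewrite eu.
      replace (k * (L - u / k)) with (k * L + - u) by (field; auto).
      rewrite <- ea. fold S. field. split; lra.
Qed.

(* The [t]-step from [q] towards [p] raises [md k (dist z .)] at least by [t] times the
   bracket, which is a one-sided derivative in the model surface. *)
Definition expanding_steps (k : R) (X : MetricSpace) : Prop :=
  forall q p (t : R), 0 <= t <= 1 -> exists u : X,
    dist q u + dist u p = dist q p /\
    t * dist q p <= dist q u <= t * sn k (dist q p) /\
    forall z, md k (dist z q) +
      t * (md k (dist z p) - md k (dist q p)
             - (1 + k ^ 2 * md k (dist q p)) * md k (dist z q)) <= md k (dist z u).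

(** The opposite estimate to [expanding_steps]. The foot of the cevian makes the first-order term
    exact only as a lower bound, so an error in [t ^ 2] appears here. The bound by the maximum keeps
    iterated steps in a bounded region. *)
Definition contracting_steps (k : R) (Y : MetricSpace) : Prop :=
  forall q p (t : R), 0 <= t <= 1 -> exists u : Y,
    forall z,
      md k (dist z u) <= Rmax (md k (dist z q)) (md k (dist z p)) /\
      md k (dist z u) <= md k (dist z q) +
        t * (md k (dist z p) - md k (dist q p)
               - (1 + k ^ 2 * md k (dist q p)) * md k (dist z q)) +
        t ^ 2 * (sn k (dist q p) ^ 2 / 2) * (1 + k ^ 2 * md k (dist z q)).

Lemma geodesic_length (Z : MetricSpace) (g : R -> Z) (p q : Z) (s : R) :
  geodesic Z g p q -> 0 <= s <= dist p q ->
  dist p (g s) = s /\ dist (g s) q = dist p q - s.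
Proof.
  intros (h0 & h1 & hd) hs. split.
  - rewrite <- h0 at 1. rewrite hd by lra. rewrite Rabs_left1; lra.
  - rewrite <- h1 at 1. rewrite hd by lra. rewrite Rabs_left1; lra.
Qed.

Lemma CBB_expanding (kappa : R) (X : MetricSpace) :
  kappa <= 0 -> CBB kappa X -> expanding_steps (sqrt (- kappa)) X.
Proof.
  intros hk [hg hX] q p t ht. pose proof (sqrt_pos (- kappa)) as hk0.
  set (k := sqrt (- kappa)) in *.
  destruct (Req_EM_T (dist q p) 0) as [e | n].
  - exists q. rewrite e, (dist_refl X q). repeat split; try lra.
    + pose proof (sn_nonneg k 0 hk0 ltac:(lra)). nra.
    + intros z. apply dist_eq0 in e. subst p. rewrite md_0. lra.
  - pose proof (dist_nonneg X q p).
    destruct (md_cevian k (dist q p) t hk0 ltac:(lra) ht)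
      as (s & a & e & hs & hts & ha & hat & he & ha1 & _ & he1 & hf).
    destruct (hg q p) as [g hgeo]. exists (g s).
    destruct (geodesic_length X g q p s hgeo hs) as [l1 l2].
    split; [lra | split; [lra |]]. intros z.
    destruct (comparison_cevian kappa X Rge g q p z s) as (D & hD & hr & hm); auto; [lra |].
    fold k in hm. apply hf in hm.
    apply Rle_trans with (md k D).
    + rewrite hm, !(dist_sym X z). pose proof (md_nonneg k (dist q z) hk0 (dist_nonneg X q z)).
      nra.
    + apply md_le; auto. rewrite (dist_sym X z). lra.
Qed.

Lemma CAT_contracting (kappa : R) (Y : MetricSpace) :
  kappa <= 0 -> CAT kappa Y -> contracting_steps (sqrt (- kappa)) Y.
Proof.
  intros hk [hg hX] q p t ht. pose proof (sqrt_pos (- kappa)) as hk0.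
  set (k := sqrt (- kappa)) in *.
  destruct (Req_EM_T (dist q p) 0) as [e | n].
  - exists q. rewrite e. intros z.
    pose proof (md_nonneg k (dist z q) hk0 (dist_nonneg Y z q)).
    split; [apply Rmax_l |]. apply dist_eq0 in e. subst p. rewrite md_0.
    assert (0 <= t ^ 2 * (sn k 0 ^ 2 / 2) * (1 + k ^ 2 * md k (dist z q))).
    { pose proof (pow2_ge_0 t). pose proof (pow2_ge_0 (sn k 0)).
      pose proof (Rmult_le_pos _ _ (pow2_ge_0 k) H).
      apply Rmult_le_pos; [apply Rmult_le_pos |]; lra. }
    lra.
  - pose proof (dist_nonneg Y q p).
    destruct (md_cevian k (dist q p) t hk0 ltac:(lra) ht)
      as (s & a & e & hs & hts & ha & hat & he & _ & ha1 & he1 & hf).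
    destruct (hg q p) as [g hgeo]. exists (g s). intros z.
    destruct (comparison_cevian kappa Y Rle g q p z s) as (D & hD & hr & hm); auto; [lra |].
    fold k in hm. apply hf in hm.
    assert (hz : md k (dist z (g s)) <= md k D).
    { apply md_le; auto. rewrite (dist_sym Y z). split; auto. apply dist_nonneg. }
    rewrite hm, !(dist_sym Y _ z) in hz.
    pose proof (md_nonneg k (dist z q) hk0 (dist_nonneg Y z q)).
    pose proof (md_nonneg k (dist z p) hk0 (dist_nonneg Y z p)).
    split.
    + pose proof (Rmax_l (md k (dist z q)) (md k (dist z p))).
      pose proof (Rmax_r (md k (dist z q)) (md k (dist z p))).
      set (M := Rmax _ _) in *. nra.
    + set (F := md k (dist q p)) in *. set (S := sn k (dist q p) ^ 2 / 2) in *.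
      set (A := md k (dist z q)) in *. nra.
Qed.

(** * Midpoints in CAT spaces *)


(** [tanh x / x] is nonincreasing: expand [sinh (y - x) / (y - x) <= sinh (x + y) / (x + y)] by the
    addition formulas. *)
Lemma tanh_quotient (x y : R) :
  0 <= x <= y -> x * (sinh y * cosh x) <= y * (cosh y * sinh x).
Proof.
  intros h. destruct (Req_EM_T y 0) as [-> |].
  { replace x with 0 by lra. lra. }
  set (t := (y - x) / (x + y)).
  assert (et : t * (x + y) = y - x) by (unfold t; field; lra).
  assert (ht : 0 <= t <= 1) by (split; nra).
  pose proof (sinh_scale t (x + y) ht ltac:(lra)) as b.
  rewrite et in b. unfold Rminus in b. rewrite !sinh_plus, cosh_opp, sinh_opp in b.
  assert ((x + y) * (sinh y * cosh x + cosh y * - sinh x)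
            <= (y - x) * (sinh x * cosh y + cosh x * sinh y)); [| lra].
  rewrite <- et.
  replace (t * (x + y) * (sinh x * cosh y + cosh x * sinh y))
    with ((x + y) * (t * (sinh x * cosh y + cosh x * sinh y))) by ring.
  apply Rmult_le_compat_l; lra.
Qed.

(** On a circle around the origin the product of the two [cosh] grows as the coordinates approach
    each other; the sign of the derivative along the circle is [tanh_quotient]. *)
Lemma cosh_mul_spread (u v w y : R) :
  0 <= v <= w -> w <= u -> 0 <= y -> u ^ 2 + v ^ 2 = w ^ 2 + y ^ 2 ->
  cosh u * cosh v <= cosh w * cosh y.
Proof.
  assert (main : forall u v w y, 0 <= v <= w -> w <= y -> 0 <= u ->
            u ^ 2 + v ^ 2 = w ^ 2 + y ^ 2 -> cosh u * cosh v <= cosh w * cosh y).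
  { clear. intros u v w y hv hw hu e.
    destruct (Req_EM_T y 0) as [-> | ny].
    { replace w with 0 by lra. replace v with 0 by lra. replace u with 0 by nra. lra. }
    set (R2 := u ^ 2 + v ^ 2) in *.
    assert (hs : forall x, v <= x <= w -> 0 < R2 - x ^ 2 /\ x <= sqrt (R2 - x ^ 2)).
    { intros x hx. assert (x ^ 2 <= w ^ 2) by nra. assert (w ^ 2 <= y ^ 2) by nra.
      assert (0 < y ^ 2) by nra.
      split; [nra |]. rewrite <- (sqrt_pow2 x) at 1 by lra. apply sqrt_le_1_alt. lra. }
    pose proof (nondecreasing_of_derive
      (fun x => cosh (sqrt (R2 - x ^ 2)) * cosh x)
      (fun x => (sqrt (R2 - x ^ 2) * (cosh (sqrt (R2 - x ^ 2)) * sinh x)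
                   - x * (sinh (sqrt (R2 - x ^ 2)) * cosh x)) / sqrt (R2 - x ^ 2)) v w) as h.
    cbv beta in h.
    replace (sqrt (R2 - v ^ 2)) with u in h
      by (unfold R2; replace (u ^ 2 + v ^ 2 - v ^ 2) with (u ^ 2) by ring;
          now rewrite sqrt_pow2).
    replace (sqrt (R2 - w ^ 2)) with y in h
      by (rewrite e; replace (w ^ 2 + y ^ 2 - w ^ 2) with (y ^ 2) by ring;
          rewrite sqrt_pow2; lra).
    rewrite (Rmult_comm (cosh w)). apply h; [lra | |].
    - intros x hx. destruct (hs x hx) as [p1 p2].
      pose proof (sqrt_lt_R0 _ p1).
      auto_derive; [simpl in *; lra |].
      replace (R2 + - (x * (x * 1))) with (R2 - x ^ 2) by ring.
      field. lra.
    - intros x hx. destruct (hs x hx) as [p1 p2].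
      pose proof (sqrt_lt_R0 _ p1).
      apply Rmult_le_pos; [| left; now apply Rinv_0_lt_compat].
      pose proof (tanh_quotient x (sqrt (R2 - x ^ 2)) ltac:(lra)). lra. }
  intros hv hw hy e.
  destruct (Rle_or_lt w y) as [l | l].
  - apply main; auto; lra.
  - rewrite (Rmult_comm (cosh w)). apply main; try lra. split; [lra | nra].
Qed.

(** A hyperbolic median is at most the Euclidean median [y] for the same side lengths. With [u], [v]
    the half sum and half difference of [B] and [C], one has [cosh D * cosh M = cosh u * cosh v] and
    [y ^ 2 + M ^ 2 = u ^ 2 + v ^ 2], and the triangle inequality places [M] between [Rabs v] and
    [u]. *)
Lemma hyperbolic_median (B C M D : R) :
  0 <= B -> 0 <= C -> 0 <= D -> 0 < M -> B <= 2 * M + C -> C <= 2 * M + B -> 2 * M <= B + C ->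
  cosh D = (sinh M * cosh B + sinh M * cosh C) / sinh (2 * M) ->
  D ^ 2 <= B ^ 2 / 2 + C ^ 2 / 2 - M ^ 2.
Proof.
  intros hB hC hD hM h1 h2 h3 e.
  assert (hS : 0 < sinh M) by now apply sinh_pos.
  pose proof (cosh_ge_1 M).
  set (u := (B + C) / 2). set (v := (B - C) / 2).
  set (y := sqrt (u ^ 2 + v ^ 2 - M ^ 2)).
  assert (hp : 0 <= u ^ 2 + v ^ 2 - M ^ 2) 
    by (pose proof (pow2_ge_0 v); assert (M ^ 2 <= u ^ 2) by (apply pow_incr; unfold u; lra); lra).
  assert (ey : y ^ 2 = u ^ 2 + v ^ 2 - M ^ 2) by (now apply pow2_sqrt).
  assert (e' : cosh D * cosh M = cosh u * cosh v).
  { rewrite e. replace B with (u + v) by (unfold u, v; field).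
    replace C with (u + - v) by (unfold u, v; field).
    rewrite !cosh_plus, cosh_opp, sinh_opp.
    replace (2 * M) with (M + M) by ring. rewrite sinh_plus. field. apply Rgt_not_eq; nra. }
  assert (hc : cosh u * cosh v <= cosh M * cosh y).
  { destruct (Rle_or_lt 0 v).
    - apply cosh_mul_spread; try (unfold u, v in *; lra). apply sqrt_pos.
    - rewrite <- (cosh_opp v). apply cosh_mul_spread; try (unfold u, v in *; lra).
      apply sqrt_pos. }
  assert (hDy : D <= y).
  { destruct (Rle_or_lt D y) as [|l]; auto.
    pose proof (cosh_lt y D (conj (sqrt_pos _) l)). nra. }
  replace (B ^ 2 / 2 + C ^ 2 / 2 - M ^ 2) with (y ^ 2) by (rewrite ey; unfold u, v; field).
  apply pow_incr; lra.
Qed.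

Definition midpoint {Y : MetricSpace} (a b m : Y) : Prop :=
  dist a m = dist a b / 2 /\ dist m b = dist a b / 2.

(** The Bruhat-Tits inequality. Convexity, nearest points and projections in [Y] rest on it alone,
    whatever the value of [kappa]. *)
Definition CAT0_midpoints (Y : MetricSpace) : Prop :=
  (forall a b : Y, exists m, midpoint a b m) /\
  forall a b m z : Y, midpoint a b m ->
    dist z m ^ 2 <= dist z a ^ 2 / 2 + dist z b ^ 2 / 2 - dist a b ^ 2 / 4.

Lemma geodesic_midpoint (Y : MetricSpace) (g : R -> Y) (a b : Y) :
  geodesic Y g a b -> midpoint a b (g (dist a b / 2)).
Proof.
  intros hg. pose proof (dist_nonneg Y a b).
  destruct (geodesic_length Y g a b (dist a b / 2) hg); [lra |]. split; lra.
Qed.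

Lemma CAT_CAT0_midpoints (kappa : R) (Y : MetricSpace) :
  kappa <= 0 -> CAT kappa Y -> CAT0_midpoints Y.
Proof.
  intros hk [hg hY].
  assert (main : forall (a b z : Y) g, geodesic Y g a b ->
    dist z (g (dist a b / 2)) ^ 2 <= dist z a ^ 2 / 2 + dist z b ^ 2 / 2 - dist a b ^ 2 / 4).
  { intros a b z g hgeo. destruct (Req_EM_T (dist a b) 0) as [e | n].
    - rewrite e. replace (0 / 2) with 0 by field. destruct hgeo as [-> _].
      apply dist_eq0 in e. subst b. lra.
    - pose proof (dist_nonneg Y a b).
      destruct (comparison_cevian kappa Y Rle g a b z (dist a b / 2)) as (D & hD & hr & hm);
        auto; [lra | lra |].
      apply Rle_trans with (D ^ 2).
      { apply pow_incr. split; [apply dist_nonneg | now rewrite dist_sym]. }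
      pose proof (dist_nonneg Y a z). pose proof (dist_nonneg Y b z).
      pose proof (dist_tri Y a b z) as t1.
      pose proof (dist_tri Y b a z) as t2. pose proof (dist_tri Y a z b) as t3.
      rewrite (dist_sym Y b a) in t2. rewrite (dist_sym Y z b) in t3.
      rewrite (dist_sym Y z a), (dist_sym Y z b).
      set (L := dist a b) in *. set (B := dist a z) in *. set (C := dist b z) in *.
      unfold model_cevian in hm. destruct (Req_EM_T (sqrt (- kappa)) 0).
      + rewrite hm. apply Req_le. field. lra.
      + pose proof (sqrt_pos (- kappa)). set (k := sqrt (- kappa)) in *.
        assert (0 < k) by lra.
        replace (L - L / 2) with (L / 2) in hm by field.
        replace (k * L) with (2 * (k * (L / 2))) in hm by field.
        apply hyperbolic_median in hm; try nra.
        assert (0 < k ^ 2) by nra. nra. }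
  split.
  - intros a b. destruct (hg a b) as [g hgeo]. eexists. now apply geodesic_midpoint with (g := g).
  - intros a b m z [h1 h2]. destruct (hg a b) as [g hgeo].
    (* Every midpoint is the geodesic one: [main] at [z := m] bounds the squared distance between
       the two by zero. *)
    replace m with (g (dist a b / 2)); [now apply main |].
    symmetry. apply dist_eq0. pose proof (main a b m g hgeo) as h.
    rewrite (dist_sym Y m a), h1, h2 in h.
    pose proof (dist_nonneg Y m (g (dist a b / 2))). nra.
Qed.

(** * The Lang-Schroeder-Sturm inequality *)


Definition lsum {A : Type} (l : list A) (F : A -> R) : R :=
  fold_right (fun x s => F x + s) 0 l.

Lemma lsum_ext {A : Type} (l : list A) (F G : A -> R) :
  (forall x, In x l -> F x = G x) -> lsum l F = lsum l G.
Proof.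
  induction l as [| x l IH]; simpl; intros h; auto.
  rewrite h by auto. rewrite IH; auto.
Qed.

Lemma lsum_le {A : Type} (l : list A) (F G : A -> R) :
  (forall x, In x l -> F x <= G x) -> lsum l F <= lsum l G.
Proof.
  induction l as [| x l IH]; simpl; intros h; [lra |].
  apply Rplus_le_compat; auto.
Qed.

Lemma lsum_plus {A : Type} (l : list A) (F G : A -> R) :
  lsum l (fun x => F x + G x) = lsum l F + lsum l G.
Proof. induction l as [| x l IH]; simpl; lra. Qed.

Lemma lsum_scal {A : Type} (l : list A) (a : R) (F : A -> R) :
  lsum l (fun x => a * F x) = a * lsum l F.
Proof. induction l as [| x l IH]; simpl; lra. Qed.

Lemma lsum_const {A : Type} (l : list A) (a : R) :
  lsum l (fun _ => a) = INR (length l) * a.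
Proof.
  induction l as [| x l IH]; [simpl; lra |].
  change (length (x :: l)) with (S (length l)). rewrite S_INR. simpl lsum. lra.
Qed.

Lemma lsum_app {A : Type} (l l' : list A) (F : A -> R) :
  lsum (l ++ l') F = lsum l F + lsum l' F.
Proof. induction l as [| x l IH]; simpl; lra. Qed.

Lemma lsum_exchange {A B : Type} (l : list A) (l' : list B) (F : A -> B -> R) :
  lsum l (fun x => lsum l' (fun y => F x y)) = lsum l' (fun y => lsum l (fun x => F x y)).
Proof.
  induction l as [| x l IH]; simpl.
  - rewrite lsum_const. lra.
  - rewrite IH, lsum_plus. reflexivity.
Qed.

Lemma lsum_nonneg {A : Type} (l : list A) (F : A -> R) :
  (forall x, In x l -> 0 <= F x) -> 0 <= lsum l F.
Proof.
  intros h. apply (lsum_le l (fun _ => 0) F) in h. rewrite lsum_const in h. lra.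
Qed.

Lemma lsum_ge_term {A : Type} (l : list A) (F : A -> R) (x : A) :
  (forall x, In x l -> 0 <= F x) -> In x l -> F x <= lsum l F.
Proof.
  induction l as [| y l IH]; simpl; [tauto |]. intros h [-> | hx].
  - pose proof (lsum_nonneg l F (fun x h' => h x (or_intror h'))). lra.
  - pose proof (IH (fun x h' => h x (or_intror h')) hx). pose proof (h y (or_introl eq_refl)). lra.
Qed.

Fixpoint copies {A : Type} (n : nat) (l : list A) : list A :=
  match n with O => [] | S m => l ++ copies m l end.

Lemma lsum_copies {A : Type} (n : nat) (l : list A) (F : A -> R) :
  lsum (copies n l) F = INR n * lsum l F.
Proof.
  induction n as [| n IH]; [simpl; lra |].
  rewrite S_INR. simpl copies. rewrite lsum_app, IH. lra.
Qed.

Lemma in_copies {A : Type} (n : nat) (l : list A) (x : A) : In x (copies n l) -> In x l.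
Proof.
  induction n as [| n IH]; simpl; [tauto |].
  rewrite in_app_iff. tauto.
Qed.

(** Repetitions in [l] act as nonnegative integer weights, so nonnegativity for all lists is
    copositivity of [c]. *)
Definition qform {A : Type} (c : A -> A -> R) (l : list A) : R :=
  lsum l (fun p => lsum l (fun q => c p q)).

(* As long as some row sum is nonnegative, deleting that element does not increase
   [qform c l + a * length l]. *)
Lemma qform_negative_rows_aux {A : Type} (c : A -> A -> R) (a : R) :
  (forall p q, c p q = c q p) ->
  forall n l, length l = n -> (forall p, In p l -> c p p <= a) ->
  qform c l + a * INR (length l) < 0 ->
  exists l', l' <> [] /\ incl l' l /\ forall p, In p l' -> lsum l' (c p) < 0.
Proof.
  intros hs. induction n as [| n IH]; intros l hl ha h.
  { destruct l; [| discriminate]. unfold qform in h. simpl in h. lra. }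
  destruct (classic (exists p, In p l /\ 0 <= lsum l (c p))) as [[p [hp hr]] | hn].
  - destruct (in_split p l hp) as (l1 & l2 & ->).
    assert (len : length (l1 ++ p :: l2) = S (length (l1 ++ l2)))
      by (rewrite !length_app; simpl; lia).
    assert (split : forall F, lsum (l1 ++ p :: l2) F = F p + lsum (l1 ++ l2) F)
      by (intros F; rewrite !lsum_app; simpl; lra).
    assert (sub : incl (l1 ++ l2) (l1 ++ p :: l2))
      by (intros x; rewrite !in_app_iff; simpl; tauto).
    destruct (IH (l1 ++ l2)) as (l' & h1 & h2 & h3).
    + lia.
    + auto.
    + rewrite len, S_INR in h. unfold qform in h |- *.
      rewrite split in h, hr.
      rewrite (lsum_ext (l1 ++ l2) _ (fun x => c p x + lsum (l1 ++ l2) (fun q => c x q))) in h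
        by (intros x _; rewrite split, (hs x p); reflexivity).
      rewrite split, lsum_plus in h.
      change (lsum (l1 ++ l2) (fun x => c p x)) with (lsum (l1 ++ l2) (c p)) in h.
      change (fun q => c p q) with (c p) in h.
      pose proof (ha p hp). lra.
    + exists l'. split; [auto | split; auto]. intros x hx. apply sub, h2, hx.
  - exists l. split; [intros ->; discriminate | split; [apply incl_refl |]].
    intros p hp. apply Rnot_le_lt. intros hr. apply hn. eauto.
Qed.

(** With [N] copies of [l] the form is multiplied by [N ^ 2] but the diagonal correction of
    [qform_negative_rows_aux] only by [N], so a large [N] absorbs it. *)
Lemma qform_negative_rows {A : Type} (c : A -> A -> R) (l : list A) :
  (forall p q, c p q = c q p) -> qform c l < 0 ->
  exists l', l' <> [] /\ incl l' l /\ forall p, In p l' -> lsum l' (c p) < 0.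
Proof.
  intros hs h. set (a := lsum l (fun p => Rabs (c p p))).
  assert (ha : 0 <= a) by (apply lsum_nonneg; intros; apply Rabs_pos).
  destruct (INR_unbounded (a * INR (length l) / - qform c l)) as [N hN].
  assert (hN' : a * INR (length l) < INR N * - qform c l).
  { apply Rmult_lt_reg_r with (/ - qform c l); [apply Rinv_0_lt_compat; lra |].
    rewrite (Rmult_assoc (INR N)), Rinv_r by lra. unfold Rdiv in hN. lra. }
  assert (hn : 0 < INR N).
  { assert (0 <= a * INR (length l)) by (apply Rmult_le_pos; [lra | apply pos_INR]). nra. }
  assert (len : INR (length (copies N l)) = INR N * INR (length l)).
  { rewrite <- (Rmult_1_r (INR (length _))), <- lsum_const, lsum_copies, lsum_const. ring. }
  destruct (qform_negative_rows_aux c a hs _ (copies N l) eq_refl) as (l' & h1 & h2 & h3).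
  - intros p hp. apply in_copies in hp.
    apply Rle_trans with (Rabs (c p p)); [apply Rle_abs |].
    apply (lsum_ge_term l (fun p => Rabs (c p p))); auto. intros; apply Rabs_pos.
  - unfold qform. rewrite lsum_copies.
    rewrite (lsum_ext l _ (fun p => INR N * lsum l (fun q => c p q)))
      by (intros; apply lsum_copies).
    rewrite lsum_scal. fold (qform c l). rewrite len.
    replace (INR N * (INR N * qform c l) + a * (INR N * INR (length l)))
      with (INR N * (a * INR (length l) - INR N * - qform c l)) by ring.
    nra.
  - exists l'. split; [auto | split; auto]. intros x hx. eapply in_copies, h2, hx.
Qed.

Lemma list_uniform_neg {A : Type} (l : list A) (F : A -> R) :
  (forall x, In x l -> F x < 0) -> exists c, 0 < c /\ forall x, In x l -> F x <= - c.
Proof.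
  induction l as [| y l IH]; intros h.
  - exists 1. split; [lra | simpl; tauto].
  - destruct IH as (c & hc & h'); [intros; apply h; simpl; auto |].
    exists (Rmin c (- F y)). pose proof (h y (or_introl eq_refl)).
    pose proof (Rmin_l c (- F y)). pose proof (Rmin_r c (- F y)).
    split; [apply Rmin_glb_lt; lra |].
    intros x [<- | hx]; [lra |]. pose proof (h' x hx). lra.
Qed.

(* In the model surface this is [sn k |zp| * sn k |zq|] times the cosine of the angle at [z]. *)
Definition gram (k : R) {X : MetricSpace} (z p q : X) : R :=
  md k (dist z p) + md k (dist z q) + k ^ 2 * (md k (dist z p) * md k (dist z q))
    - md k (dist p q).

Lemma gram_sym (k : R) (X : MetricSpace) (z p q : X) : gram k z p q = gram k z q p.
Proof. unfold gram. rewrite (dist_sym X p q). ring. Qed.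

Lemma gram_lipschitz (k : R) (X : MetricSpace) (z : X) (b : R) : 0 <= k -> 0 <= b ->
  exists K, 0 < K /\ forall u p q : X, dist z u <= 1 -> dist z p <= b -> dist z q <= b ->
    gram k u p q <= gram k z p q + K * dist z u.
Proof.
  intros hk hb. destruct (md_lipschitz k (b + 1) hk ltac:(lra)) as (G & hG & lip).
  set (M := md k (b + 1)).
  assert (hM : 0 <= M) by (apply md_nonneg; lra).
  assert (hk2 : 0 <= k ^ 2) by nra.
  assert (hkM : 0 <= k ^ 2 * M) by (now apply Rmult_le_pos).
  exists (2 * G + 2 * (k ^ 2 * M * G)). split.
  { assert (0 <= k ^ 2 * M * G) by (apply Rmult_le_pos; lra). lra. }
  intros u p q hu hp hq.
  assert (one : forall p, dist z p <= b -> 0 <= md k (dist u p) <= M /\ 0 <= md k (dist z p) <= M /\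
            md k (dist u p) <= md k (dist z p) + G * dist z u).
  { clear p q hp hq. intros p hp.
    pose proof (dist_nonneg X u p). pose proof (dist_nonneg X z p).
    pose proof (dist_tri X u z p) as t1. pose proof (dist_tri X z u p) as t2.
    rewrite (dist_sym X u z) in t1.
    split; [split; [apply md_nonneg; auto | apply md_le; lra] |].
    split; [split; [apply md_nonneg; auto | apply md_le; lra] |].
    pose proof (lip (dist u p) (dist z p) ltac:(lra) ltac:(lra)) as h.
    apply Rle_trans with (md k (dist z p) + G * Rabs (dist u p - dist z p)).
    - pose proof (Rle_abs (md k (dist u p) - md k (dist z p))). lra.
    - apply Rplus_le_compat_l, Rmult_le_compat_l; [lra |]. apply Rabs_le. lra. }
  destruct (one p hp) as (a1 & a2 & a3). destruct (one q hq) as (b1 & b2 & b3).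
  unfold gram. set (e := dist z u) in *. pose proof (dist_nonneg X z u). fold e in H.
  set (P := md k (dist u p)) in *. set (P0 := md k (dist z p)) in *.
  set (Q := md k (dist u q)) in *. set (Q0 := md k (dist z q)) in *.
  assert (hGe : 0 <= G * e) by nra.
  assert (P * Q <= P0 * Q0 + 2 * (M * (G * e))).
  { assert (P * Q <= (P0 + G * e) * Q) by (apply Rmult_le_compat_r; lra).
    assert (P0 * Q <= P0 * (Q0 + G * e)) by (apply Rmult_le_compat_l; lra).
    assert (G * e * Q <= G * e * M) by (apply Rmult_le_compat_l; lra).
    assert (P0 * (G * e) <= M * (G * e)) by (apply Rmult_le_compat_r; lra).
    lra. }
  assert (k ^ 2 * (P * Q) <= k ^ 2 * (P0 * Q0 + 2 * (M * (G * e)))) by (apply Rmult_le_compat_l; lra).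
  lra.
Qed.

Lemma pos_below (a b c d : R) : 0 < a -> 0 < b -> 0 < c -> 0 < d ->
  exists t, 0 < t /\ t <= a /\ t <= b /\ t <= c /\ t <= d.
Proof.
  intros ha hb hc hd. exists (Rmin (Rmin a b) (Rmin c d)).
  pose proof (Rmin_l a b). pose proof (Rmin_r a b). pose proof (Rmin_l c d). pose proof (Rmin_r c d).
  pose proof (Rmin_l (Rmin a b) (Rmin c d)). pose proof (Rmin_r (Rmin a b) (Rmin c d)).
  split; [repeat apply Rmin_glb_lt; auto |]. lra.
Qed.

(* If all row sums at [z] were negative, [Phi = sum_p md k (dist p .)] would grow at a
   definite rate towards every [p] in [l] from every point near [z].  Let [q] almost
   maximise [Phi] on a small ball around [z], and let [u] be slightly closer to [z] on a
   geodesic.  A step from [u] towards [p] that makes up for the loss from [q] to [u] must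
   leave the ball, so the comparison along [q z] shows that its end is hardly farther from
   [q] than from [u]; hence [dist u p >= dist q p - O(t^2)], and [Phi u >= Phi q - O(t^2)].
   A step of length [dist q u] from [u] then stays in the ball and beats the maximum. *)
Lemma gram_row_nonneg (k : R) (X : MetricSpace) (z : X) (l : list X) :
  0 <= k -> expanding_steps k X -> l <> [] ->
  exists p, In p l /\ 0 <= lsum l (gram k z p).
Proof.
  intros hk hX hl.
  destruct (classic (exists p, In p l /\ 0 <= lsum l (gram k z p))) as [|hn]; auto.
  exfalso.
  destruct (list_uniform_neg l (fun p => lsum l (gram k z p))) as (c & hc & hrow).
  { intros p hp. apply Rnot_le_lt. intros h. apply hn. eauto. }
  clear hn.
  set (b := lsum l (dist z)).
  assert (hb0 : 0 <= b) by (apply lsum_nonneg; intros; apply dist_nonneg).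
  assert (hb : forall p, In p l -> dist z p <= b)
    by (intros p hp; apply (lsum_ge_term l (dist z)); auto; intros; apply dist_nonneg).
  destruct (gram_lipschitz k X z b hk hb0) as (K & hK & lipK).
  destruct (md_lipschitz k (b + 1) hk ltac:(lra)) as (G & hG & lip).
  set (n := INR (length l)). assert (hn0 : 0 <= n) by apply pos_INR.
  set (S := sn k (b + 1) + 1).
  assert (hS : 1 <= S) by (pose proof (sn_nonneg k (b + 1) hk ltac:(lra)); unfold S; lra).
  (* By [gram_lipschitz] the row sums stay below [- (c / 2)] on the ball of radius [tau]; this is
     the growth rate in [gain]. *)
  assert (htau : exists tau, 0 < tau <= 1 / 2 /\ n * K * tau <= c / 2).
  { assert (0 < n * K + 1) by nra.
    destruct (pos_below (1/2) (1/2) (c / 2 / (n * K + 1)) 1) as (tau & h1 & h2 & _ & h3 & _); try lra.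
    { repeat apply Rdiv_lt_0_compat; lra. }
    exists tau. split; [lra |]. apply Rmult_le_compat_r with (r := n * K + 1) in h3; [| lra].
    unfold Rdiv in h3 at 1. rewrite Rmult_assoc, Rinv_l in h3 by lra. nra. }
  destruct htau as (tau & htau & htau2).
  set (Phi := fun u => lsum l (fun p => md k (dist p u))).
  assert (near : forall u p, dist z u <= 1 -> In p l -> 0 <= dist p u <= b + 1).
  { intros u p hu hp. pose proof (hb p hp). pose proof (dist_tri X p z u).
    rewrite (dist_sym X p z) in *. pose proof (dist_nonneg X p u). lra. }
  assert (hPhi : forall u v e, dist z u <= 1 -> dist z v <= 1 -> 0 <= e ->
            (forall p, In p l -> dist p u <= dist p v + e) -> Phi u <= Phi v + n * G * e).
  { intros u v e hu hv he h. unfold Phi.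
    rewrite (Rmult_assoc n). unfold n. rewrite <- lsum_const, <- lsum_plus. apply lsum_le. intros p hp.
    pose proof (near u p hu hp). pose proof (near v p hv hp). pose proof (h p hp).
    destruct (Rle_or_lt (dist p u) (dist p v)).
    - pose proof (md_le k (dist p u) (dist p v) hk ltac:(lra)). nra.
    - pose proof (lip (dist p u) (dist p v) ltac:(lra) ltac:(lra)) as hh.
      pose proof (Rle_abs (md k (dist p u) - md k (dist p v))).
      rewrite (Rabs_pos_eq (dist p u - _)) in hh by lra. nra. }
  assert (gain : forall u p r, dist z u <= tau -> In p l -> 0 <= r <= 1 ->
            exists u', dist u u' + dist u' p = dist u p /\ dist u u' <= r * S /\
              Phi u + r * (c / 2) <= Phi u').
  { intros u p r hu hp hr.
    destruct (hX u p r hr) as (u' & h1 & h2 & h3). exists u'. split; [auto |].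
    pose proof (near u p ltac:(lra) hp) as hup. rewrite dist_sym in hup.
    split.
    - apply Rle_trans with (1 := proj2 h2). apply Rmult_le_compat_l; [lra |].
      pose proof (sn_le k _ _ hk hup). unfold S. lra.
    - assert (hr2 : lsum l (gram k u p) <= - (c / 2)).
      { apply Rle_trans with (lsum l (fun q => gram k z p q + K * dist z u)).
        - apply lsum_le. intros q hq. apply lipK; auto; lra.
        - rewrite lsum_plus, lsum_const. pose proof (hrow p hp) as h. cbv beta in h.
          change (fun q => gram k z p q) with (gram k z p). fold n.
          assert (n * (K * dist z u) <= n * K * tau).
          { rewrite Rmult_assoc. repeat apply Rmult_le_compat_l; lra. }
          lra. }
      assert (step : Phi u + r * - lsum l (gram k u p) <= Phi u').
      { unfold Phi. rewrite <- Ropp_mult_distr_r.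
        replace (- (r * lsum l (gram k u p))) with (- r * lsum l (gram k u p)) by ring.
        rewrite <- lsum_scal, <- lsum_plus. apply lsum_le. intros q hq.
        apply Rle_trans with (2 := h3 q). unfold gram. rewrite (dist_sym X p q), (dist_sym X u q).
        apply Req_le. ring. }
      nra. }
  set (E := fun v => exists u, dist z u <= tau /\ v = Phi u).
  destruct (completeness E) as (V & Vub & Vlub).
  { exists (lsum l (fun p => md k (b + 1))). intros v (u & hu & ->). apply lsum_le.
    intros p hp. pose proof (near u p ltac:(lra) hp). apply md_le; lra. }
  { exists (Phi z), z. rewrite dist_refl. split; [lra | auto]. }
  set (W := 1 + k ^ 2 * md k 1).
  assert (hW : 1 <= W).
  { unfold W. pose proof (Rmult_le_pos _ _ (pow2_ge_0 k) (md_nonneg k 1 hk ltac:(lra))). lra. }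
  (* For the step [t] from [q] to [u]: a step of ratio at most [t * Cr] recovers the loss in [Phi],
     [C2 * t ^ 2] bounds the excess of [dist p q] over [dist p u], and [t ^ 2 * C3] is the final
     deficit, to be beaten by the gain [t * g]. *)
  set (Cr := (n * G * S + 2) / (c / 2)).
  assert (hnGS : 0 <= n * G * S) by (repeat apply Rmult_le_pos; lra).
  assert (hCr : 0 < Cr) by (unfold Cr; apply Rdiv_lt_0_compat; lra).
  assert (eCr : Cr * (c / 2) = n * G * S + 2) by (unfold Cr; field; lra). clearbody Cr.
  set (C2 := 2 * W * (Cr * S)).
  assert (hC2 : 0 <= C2) by (unfold C2; repeat apply Rmult_le_pos; lra).
  set (C3 := 1 + n * G * C2).
  assert (hC3 : 1 <= C3) by (unfold C3; assert (0 <= n * G * C2) by (repeat apply Rmult_le_pos; lra); lra).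
  set (g := (c / 2) * (tau / (2 * S))).
  assert (hg : 0 < g) by (unfold g; apply Rmult_lt_0_compat; [lra | apply Rdiv_lt_0_compat; lra]).
  destruct (pos_below 1 (/ (2 * W)) (/ Cr) (g / (2 * C3))) as (t & t0 & t1 & t2 & t3 & t4);
    [lra | apply Rinv_0_lt_compat; lra | now apply Rinv_0_lt_compat | apply Rdiv_lt_0_compat; lra |].
  assert (t2' : t * W <= 1 / 2).
  { apply Rmult_le_compat_r with (r := W) in t2; [| lra].
    replace (/ (2 * W) * W) with (1 / 2) in t2 by (field; lra). lra. }
  assert (t3' : t * Cr <= 1).
  { apply Rmult_le_compat_r with (r := Cr) in t3; [| lra]. rewrite Rinv_l in t3; lra. }
  assert (t4' : t * C3 < g).
  { apply Rmult_le_compat_r with (r := C3) in t4; [| lra].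
    replace (g / (2 * C3) * C3) with (g / 2) in t4 by (field; lra). lra. }
  assert (tt : 0 < t ^ 2 <= t) by nra.
  assert (hq : exists q, dist z q <= tau /\ V - t ^ 2 < Phi q).
  { destruct (classic (exists q, dist z q <= tau /\ V - t ^ 2 < Phi q)) as [|hno]; auto.
    exfalso. enough (V <= V - t ^ 2) by lra. apply Vlub. intros v (u & hu & ->).
    apply Rnot_lt_le. intros hlt. apply hno. eauto. }
  destruct hq as (q & hqz & hqV).
  assert (Vmax : forall u, dist z u <= tau -> Phi u <= V) by (intros u hu; apply Vub; exists u; auto).
  destruct l as [| p0 l0]; [now destruct hl |].
  assert (hp0 : In p0 (p0 :: l0)) by (simpl; auto).
  assert (htS : tau / (2 * S) * S = tau / 2) by (field; lra).
  assert (htS1 : 0 < tau / (2 * S) <= 1).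
  { split; [apply Rdiv_lt_0_compat; lra |]. nra. }
  (* In the inner half of the ball a step of length at most [tau / 2] would stay in the ball and
     gain [g], more than [t ^ 2]. *)
  assert (hqfar : tau / 2 < dist z q).
  { apply Rnot_le_lt. intros hle.
    destruct (gain q p0 (tau / (2 * S)) hqz hp0 ltac:(lra)) as (u' & _ & h1 & h2).
    pose proof (dist_tri X z q u'). rewrite htS in h1.
    pose proof (Vmax u' ltac:(lra)). fold g in h2. unfold g in *. nra. }
  destruct (hX q z t ltac:(lra)) as (u & hqu & hqu' & hu).
  rewrite (dist_sym X q z), (dist_sym X u z) in hqu. rewrite (dist_sym X q z) in hqu'.
  assert (hqs : dist q u <= t * S).
  { apply Rle_trans with (1 := proj2 hqu'). apply Rmult_le_compat_l; [lra |].
    pose proof (sn_le k (dist z q) (b + 1) hk ltac:(lra)). unfold S. lra. }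
  pose proof (dist_nonneg X q u) as hqu0.
  assert (hzu : dist z u <= tau) by lra.
  assert (hub : Phi q - n * G * dist q u <= Phi u).
  { enough (Phi q <= Phi u + n * G * dist q u) by lra.
    apply hPhi; try lra. intros p _. rewrite (dist_sym X q u). apply dist_tri. }
  assert (key : forall p, In p (p0 :: l0) -> dist p q <= dist p u + C2 * t ^ 2).
  { intros p hp.
    (* The gain [r * (c / 2)] covers the loss from [q] to [u] and lifts [Phi] above its supremum
       [V], so [p'] cannot lie in the ball. *)
    set (r := (n * G * dist q u + 2 * t ^ 2) / (c / 2)).
    assert (er : r * (c / 2) = n * G * dist q u + 2 * t ^ 2) by (unfold r; field; lra).
    assert (hnG : 0 <= n * G) by nra.
    assert (hr0 : 0 <= r).
    { apply Rmult_le_reg_r with (c / 2); [lra |]. rewrite er.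
      pose proof (Rmult_le_pos _ _ hnG hqu0). lra. }
    assert (hr : r <= t * Cr).
    { apply Rmult_le_reg_r with (c / 2); [lra |]. rewrite er.
      replace (t * Cr * (c / 2)) with (t * (Cr * (c / 2))) by ring. rewrite eCr.
      pose proof (Rmult_le_compat_l _ _ _ hnG hqs). nra. }
    destruct (gain u p r hzu hp ltac:(lra)) as (p' & e1 & e2 & e3).
    assert (hout : tau < dist z p').
    { apply Rnot_le_lt. intros hle. pose proof (Vmax p' hle). lra. }
    pose proof (hu p') as hc'.
    rewrite (dist_sym X p' z), (dist_sym X q z), (dist_sym X p' q), (dist_sym X p' u) in hc'.
    assert (hm : md k (dist z q) <= md k (dist z p')).
    { apply md_le; auto. split; [apply dist_nonneg | lra]. }
    assert (hm1 : md k (dist z q) <= md k 1).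
    { apply md_le; auto. split; [apply dist_nonneg | lra]. }
    pose proof (dist_nonneg X u p') as hr1. pose proof (dist_nonneg X q p') as hD.
    assert (hW' : 1 + k ^ 2 * md k (dist z q) <= W)
      by (unfold W; apply Rplus_le_compat_l, Rmult_le_compat_l; [apply pow2_ge_0 | auto]).
    set (w := 1 + k ^ 2 * md k (dist z q)) in *.
    (* As [p'] is farther from [z] than [q] is, the step inequality for [u] seen from [p'] leaves
       [(1 - t * w) * D <= Rr]; [md_scale] and [(1 + 2 * x) * (1 - x) >= 1] for [0 <= x <= 1 / 2]
       convert it to distances. *)
    assert (hDr : dist q p' <= (1 + 2 * (t * W)) * dist u p').
    { apply Rnot_lt_le. intros hlt.
      assert (tW : 0 <= t * W) by (apply Rmult_le_pos; lra).
      assert (tw : t * w <= t * W) by (apply Rmult_le_compat_l; lra).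
      pose proof (md_lt k _ _ hk (conj (Rmult_le_pos _ _ (ltac:(lra) : 0 <= 1 + 2 * (t * W)) hr1) hlt)) as a1.
      pose proof (md_scale k (1 + 2 * (t * W)) (dist u p') hk ltac:(lra) hr1) as a2.
      pose proof (md_nonneg k (dist q p') hk hD) as a3.
      set (D := md k (dist q p')) in *. set (Rr := md k (dist u p')) in *.
      assert (a4 : D * (1 - t * w) <= Rr) by nra.
      assert (a5 : D * (1 - t * W) <= Rr) by nra.
      assert (a6 : (1 + 2 * (t * W)) * (D * (1 - t * W)) <= (1 + 2 * (t * W)) * Rr)
        by (apply Rmult_le_compat_l; lra).
      assert (a7 : 0 <= D * ((t * W) * (1 - 2 * (t * W)))) by (repeat apply Rmult_le_pos; lra).
      lra. }
    pose proof (dist_tri X q p' p) as tri.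
    rewrite (dist_sym X p q), (dist_sym X p u).
    assert (dist u p' <= t * (Cr * S)).
    { apply Rle_trans with (1 := e2). rewrite <- Rmult_assoc. apply Rmult_le_compat_r; lra. }
    assert (2 * (t * W) * dist u p' <= 2 * (t * W) * (t * (Cr * S))).
    { apply Rmult_le_compat_l; [|auto]. repeat apply Rmult_le_pos; lra. }
    unfold C2. simpl. lra. }
  assert (hu2 : Phi q <= Phi u + n * G * (C2 * t ^ 2)).
  { apply hPhi; auto; try lra. apply Rmult_le_pos; lra. }
  destruct (gain u p0 (t * (tau / (2 * S))) hzu hp0) as (u2 & _ & h1 & h2).
  { split; [apply Rmult_le_pos; lra |]. nra. }
  rewrite Rmult_assoc, htS in h1.
  pose proof (dist_tri X z u u2) as tri.
  assert (t * (tau / 2) <= dist q u) by nra.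
  pose proof (Vmax u2 ltac:(lra)) as hfin.
  assert (e1 : t * (tau / (2 * S)) * (c / 2) = t * g) by (unfold g; ring).
  rewrite e1 in h2.
  assert (e2 : t ^ 2 + n * G * (C2 * t ^ 2) = t * (t * C3)) by (unfold C3; ring).
  assert (t * (t * C3) < t * g) by (apply Rmult_lt_compat_l; lra).
  lra.
Qed.

(** The Lang-Schroeder-Sturm inequality: a negative value would leave a sublist all of whose rows
    are negative. *)
Theorem gram_copositive (k : R) (X : MetricSpace) (z : X) (l : list X) :
  0 <= k -> expanding_steps k X -> 0 <= qform (gram k z) l.
Proof.
  intros hk hX. apply Rnot_lt_le. intros h.
  destruct (qform_negative_rows (gram k z) l (gram_sym k X z) h) as (l' & h1 & _ & h3).
  destruct (gram_row_nonneg k X z l' hk hX h1) as (p & hp & hr).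
  pose proof (h3 p hp). lra.
Qed.

(** * Intersections of balls *)


Lemma sn_sq (k x : R) : 0 <= k -> sn k x ^ 2 = 2 * md k x + k ^ 2 * md k x ^ 2.
Proof.
  intros hk. unfold sn, md. destruct (Req_EM_T k 0) as [-> | hk0]; [field |].
  pose proof (cosh_sq (k * x)) as h.
  replace ((sinh (k * x) / k) ^ 2) with (sinh (k * x) * sinh (k * x) / k ^ 2) by (field; auto).
  replace (sinh (k * x) * sinh (k * x)) with (cosh (k * x) * cosh (k * x) - 1) by lra.
  field. auto.
Qed.

Lemma lsum_map {A B : Type} (f : A -> B) (l : list A) (F : B -> R) :
  lsum (map f l) F = lsum l (fun x => F (f x)).
Proof. induction l as [| x l IH]; simpl; auto. now rewrite IH. Qed.

Lemma lsum_seq_S (n : nat) (F : nat -> R) : lsum (seq 0 (S n)) F = lsum (seq 0 n) F + F n.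
Proof. rewrite seq_S, lsum_app. simpl. lra. Qed.

(* Walk: from the current point make a [t]-step towards a centre whose ball is violated by
   more than [eps].  Summing the step inequalities over all steps telescopes; averaging the
   result over the visited centres (weight 1) and over the visited points (weight [W])
   bounds the averaged excess by the failure of copositivity, up to [O(t + 1/(n t))]. *)
Lemma finite_balls_approx (k : R) (Y : MetricSpace) (I : Type) (J : list I)
  (y : I -> Y) (e : I -> R) (eps : R) :
  0 <= k -> contracting_steps k Y -> J <> [] -> 0 < eps -> (forall i, In i J -> 0 <= e i) ->
  (forall l, incl l J ->
     0 <= qform (fun i j => e i + e j + k ^ 2 * (e i * e j) - md k (dist (y i) (y j))) l) ->
  exists z, forall i, In i J -> md k (dist (y i) z) <= e i + eps.
Proof.
  intros hk hY hJ heps he hcop.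
  destruct (classic (exists z, forall i, In i J -> md k (dist (y i) z) <= e i + eps)) as [|hn]; auto.
  exfalso.
  assert (hviol : forall z : Y, exists i, In i J /\ e i + eps < md k (dist (y i) z)).
  { intros z. destruct (classic (exists i, In i J /\ e i + eps < md k (dist (y i) z))) as [|h]; auto.
    exfalso. apply hn. exists z. intros i hi. apply Rnot_lt_le. intros hlt. apply h. eauto. }
  clear hn.
  set (viol := fun z => proj1_sig (constructive_indefinite_description _ (hviol z))).
  assert (hv : forall z, In (viol z) J /\ e (viol z) + eps < md k (dist (y (viol z)) z))
    by (intros z; apply (proj2_sig (constructive_indefinite_description _ (hviol z)))).
  clearbody viol. clear hviol.
  destruct J as [| i0 J0]; [now destruct hJ |]. set (J := i0 :: J0) in *.
  assert (hi0 : In i0 J) by (simpl; auto).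
  assert (mdp : forall a b : Y, 0 <= md k (dist a b))
    by (intros; apply md_nonneg; auto; apply dist_nonneg).
  set (M := lsum J (fun i => lsum J (fun j => md k (dist (y i) (y j))))).
  assert (hM0 : 0 <= M) by (repeat (apply lsum_nonneg; intros); auto).
  assert (hM : forall i j, In i J -> In j J -> md k (dist (y i) (y j)) <= M).
  { intros i j hi hj.
    apply Rle_trans with (lsum J (fun j => md k (dist (y i) (y j)))).
    - apply (lsum_ge_term J (fun j => md k (dist (y i) (y j)))); auto.
    - apply (lsum_ge_term J (fun i => lsum J (fun j => md k (dist (y i) (y j))))); auto.
      intros; apply lsum_nonneg; auto. }
  set (Wb := 1 + k ^ 2 * M).
  assert (hk2 : 0 <= k ^ 2) by apply pow2_ge_0.
  assert (hWb : 1 <= Wb) by (unfold Wb; pose proof (Rmult_le_pos _ _ hk2 hM0); lra).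
  (* Bounds the coefficient of [t ^ 2] in one step, through [sn_sq]. *)
  set (Bd := (M + k ^ 2 * M ^ 2 / 2) * Wb).
  assert (hBd : 0 <= Bd).
  { apply Rmult_le_pos; [|lra]. pose proof (Rmult_le_pos _ _ hk2 (pow2_ge_0 M)). lra. }
  assert (ht : exists t, 0 < t <= 1 /\ (1 + Wb) * Bd * t <= eps).
  { assert (hp : 0 <= (1 + Wb) * Bd) by (apply Rmult_le_pos; lra).
    assert (hq : 0 < eps / ((1 + Wb) * Bd + 1)) by (apply Rdiv_lt_0_compat; lra).
    exists (Rmin 1 (eps / ((1 + Wb) * Bd + 1))).
    split; [split; [apply Rmin_glb_lt; lra | apply Rmin_l] |].
    apply Rle_trans with (((1 + Wb) * Bd + 1) * (eps / ((1 + Wb) * Bd + 1))).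
    - apply Rmult_le_compat; [lra | apply Rmin_glb; lra | lra | apply Rmin_r].
    - apply Req_le. field. lra. }
  destruct ht as (t & ht & htB).
  assert (hstep : forall q p, exists u : Y, forall z,
      md k (dist z u) <= Rmax (md k (dist z q)) (md k (dist z p)) /\
      md k (dist z u) <= md k (dist z q) +
        t * (md k (dist z p) - md k (dist q p)
               - (1 + k ^ 2 * md k (dist q p)) * md k (dist z q)) +
        t ^ 2 * (sn k (dist q p) ^ 2 / 2) * (1 + k ^ 2 * md k (dist z q)))
    by (intros; apply hY; lra).
  set (step := fun q p => proj1_sig (constructive_indefinite_description _ (hstep q p))).
  assert (hst := fun q p => proj2_sig (constructive_indefinite_description _ (hstep q p))).
  change (forall q p, forall z,
      md k (dist z (step q p)) <= Rmax (md k (dist z q)) (md k (dist z p)) /\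
      md k (dist z (step q p)) <= md k (dist z q) +
        t * (md k (dist z p) - md k (dist q p)
               - (1 + k ^ 2 * md k (dist q p)) * md k (dist z q)) +
        t ^ 2 * (sn k (dist q p) ^ 2 / 2) * (1 + k ^ 2 * md k (dist z q))) in hst.
  clearbody step. clear hstep.
  set (w := fix w (n : nat) : Y :=
              match n with O => y i0 | S m => step (w m) (y (viol (w m))) end).
  set (p := fun n => y (viol (w n))).
  assert (w_S : forall n, w (S n) = step (w n) (p n)) by reflexivity.
  assert (w_0 : w O = y i0) by reflexivity.
  clearbody w.
  assert (A : forall n i, In i J -> md k (dist (y i) (w n)) <= M).
  { induction n as [| n IH]; intros i hi; [rewrite w_0; now apply hM |].
    rewrite w_S. apply Rle_trans with (1 := proj1 (hst _ _ _)). apply Rmax_lub; auto.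
    apply hM; auto. apply hv. }
  assert (pw : forall n m, md k (dist (p n) (w m)) <= M) by (intros; apply A, hv).
  assert (ww : forall n m, md k (dist (w m) (w n)) <= M).
  { induction n as [| n IH]; intros m; [rewrite w_0, dist_sym; now apply A |].
    rewrite w_S. apply Rle_trans with (1 := proj1 (hst _ _ _)). apply Rmax_lub; auto.
    rewrite dist_sym. apply pw. }
  set (F := fun n => md k (dist (p n) (w n))).
  set (W := fun n => 1 + k ^ 2 * F n).
  assert (hF : forall n, 0 <= F n <= M) by (intros; split; [apply mdp | apply pw]).
  assert (hW : forall n, 1 <= W n <= Wb).
  { intros n. unfold W, Wb. destruct (hF n) as [f1 f2].
    pose proof (Rmult_le_pos _ _ hk2 f1). pose proof (Rmult_le_compat_l _ _ _ hk2 f2). lra. }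
  assert (tele : forall z, (forall n, md k (dist z (w n)) <= M) -> forall K,
      t * (lsum (seq 0 K) F + lsum (seq 0 K) (fun n => W n * md k (dist z (w n))))
        + md k (dist z (w K))
      <= t * lsum (seq 0 K) (fun n => md k (dist z (p n))) + M + INR K * (t ^ 2 * Bd)).
  { intros z hz. induction K as [| K IH].
    - pose proof (hz O). simpl. lra.
    - rewrite !lsum_seq_S, S_INR.
      destruct (hst (w K) (p K) z) as [_ h]. rewrite <- w_S in h.
      rewrite (dist_sym Y (w K) (p K)) in h. fold (F K) in h. fold (W K) in h.
      assert (hs : sn k (dist (p K) (w K)) ^ 2 / 2 * (1 + k ^ 2 * md k (dist z (w K))) <= Bd).
      { rewrite sn_sq by auto. fold (F K). destruct (hF K) as [f1 f2]. unfold Bd, Wb.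
        pose proof (hz K) as z2. pose proof (mdp z (w K)) as z1.
        assert (F K ^ 2 <= M ^ 2) by (apply pow_incr; lra).
        pose proof (Rmult_le_compat_l _ _ _ hk2 H).
        pose proof (Rmult_le_pos _ _ hk2 (pow2_ge_0 (F K))).
        pose proof (Rmult_le_compat_l _ _ _ hk2 z2). pose proof (Rmult_le_pos _ _ hk2 z1).
        apply Rmult_le_compat; lra. }
      pose proof (Rmult_le_compat_l (t ^ 2) _ _ (pow2_ge_0 t) hs). lra. }
  assert (main : forall K, 2 * t * INR K * eps <= (1 + Wb) * (M + INR K * (t ^ 2 * Bd)) \/ INR K <= 0).
  { intros K. destruct (Rle_or_lt (INR K) 0) as [|hK]; [now right | left].
    set (L := seq 0 K). set (SF := lsum L F). set (n := INR K) in *.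
    set (err := M + n * (t ^ 2 * Bd)).
    assert (len : INR (length L) = n) by (unfold L; now rewrite length_seq).
    set (X1 := lsum L (fun l => lsum L (fun n => W n * md k (dist (p l) (w n))))).
    set (X2 := lsum L (fun j => W j * lsum L (fun n => W n * md k (dist (w j) (w n))))).
    set (PP := lsum L (fun l => lsum L (fun n => md k (dist (p l) (p n))))).
    assert (i1 : t * (n * SF + X1) <= t * PP + n * err).
    { assert (h : lsum L (fun l => t * (SF + lsum L (fun n => W n * md k (dist (p l) (w n)))))
                 <= lsum L (fun l => t * lsum L (fun n => md k (dist (p l) (p n))) + err)).
      { apply lsum_le. intros l _. pose proof (tele (p l) (fun m => pw l m) K) as h.
        pose proof (mdp (p l) (w K)). unfold err. fold n L SF in h. lra. }
      rewrite lsum_plus, !lsum_scal, lsum_plus, !lsum_const, len in h. exact h. }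
    assert (eX : lsum L (fun j => W j * lsum L (fun n => md k (dist (w j) (p n)))) = X1).
    { unfold X1. rewrite lsum_exchange. apply lsum_ext. intros j _. rewrite lsum_scal.
      f_equal. apply lsum_ext. intros l _. now rewrite dist_sym. }
    assert (eW : lsum L W = n + k ^ 2 * SF).
    { unfold W. rewrite lsum_plus, lsum_scal, lsum_const, len. unfold SF. ring. }
    assert (herr : 0 <= err).
    { unfold err. assert (0 <= n * (t ^ 2 * Bd)); [| lra].
      apply Rmult_le_pos; [lra |]. apply Rmult_le_pos; [apply pow2_ge_0 | auto]. }
    (* The averages over visited points, with weights [W j], carry the cross term [X1] on the other
       side from [i1]; adding both cancels it and leaves [2 * n * SF + k ^ 2 * SF ^ 2] against
       [PP]. *)
    assert (i2 : t * ((n + k ^ 2 * SF) * SF + X2) <= t * X1 + n * (Wb * err)).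
    { assert (h : lsum L (fun j => t * (SF * W j + W j * lsum L (fun n => W n * md k (dist (w j) (w n)))))
                 <= lsum L (fun j => t * (W j * lsum L (fun n => md k (dist (w j) (p n)))) + Wb * err)).
      { apply lsum_le. intros j _. pose proof (tele (w j) (fun m => ww m j) K) as h.
        pose proof (mdp (w j) (w K)). fold n L SF in h. fold err in h. destruct (hW j) as [W1 W2].
        set (a := lsum L (fun n => W n * md k (dist (w j) (w n)))) in *.
        set (b := lsum L (fun n => md k (dist (w j) (p n)))) in *.
        assert (h' : t * (SF + a) <= t * b + err) by (unfold err; lra).
        apply (Rmult_le_compat_l (W j)) in h'; [| lra].
        pose proof (Rmult_le_compat_r err _ _ herr W2). lra. }
      rewrite lsum_plus, !lsum_scal, lsum_plus, !lsum_const, len, lsum_scal, eX, eW in h.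
      fold X2 in h. lra. }
    assert (hX2 : 0 <= X2).
    { apply lsum_nonneg. intros j _. destruct (hW j). apply Rmult_le_pos; [lra |].
      apply lsum_nonneg. intros m _. destruct (hW m). apply Rmult_le_pos; [lra | apply mdp]. }
    set (SE := lsum L (fun n => e (viol (w n)))).
    assert (hSE : 0 <= SE) by (apply lsum_nonneg; intros; apply he, hv).
    (* Copositivity for the list of visited centres, each repeated as often as it was visited. Since
       every visit had excess [eps], [SF] exceeds [SE] by [n * eps]. *)
    assert (hPP : PP <= 2 * n * SE + k ^ 2 * SE ^ 2).
    { pose proof (hcop (map (fun n => viol (w n)) L)) as h. unfold qform in h.
      rewrite lsum_map in h.
      assert (eq : lsum L (fun x => lsum (map (fun n => viol (w n)) L)
          (fun q => e (viol (w x)) + e q + k ^ 2 * (e (viol (w x)) * e q)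
                      - md k (dist (y (viol (w x))) (y q))))
          = 2 * n * SE + k ^ 2 * SE ^ 2 - PP).
      { transitivity (lsum L (fun x => n * e (viol (w x)) + (SE + (k ^ 2 * SE * e (viol (w x))
           + - 1 * lsum L (fun n => md k (dist (p x) (p n))))))).
        - apply lsum_ext. intros x _. rewrite lsum_map.
          transitivity (lsum L (fun m => e (viol (w x)) + (e (viol (w m))
             + ((k ^ 2 * e (viol (w x))) * e (viol (w m)) + - 1 * md k (dist (p x) (p m)))))).
          + apply lsum_ext. intros m _. unfold p. ring.
          + rewrite !lsum_plus, !lsum_scal, lsum_const, len. fold SE. ring.
        - rewrite !lsum_plus, !lsum_scal, lsum_const, len. fold SE PP. ring. }
      rewrite eq in h. enough (incl (map (fun n => viol (w n)) L) J) as hi by (apply h in hi; lra).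
      intros i hi. apply in_map_iff in hi. destruct hi as (m & <- & _). apply hv. }
    assert (hSF : SE + n * eps <= SF).
    { unfold SE, SF. rewrite <- len, <- (lsum_const L eps), <- lsum_plus. apply lsum_le.
      intros m _. left. apply hv. }
    assert (hne : 0 <= n * eps) by nra.
    assert (c1 : k ^ 2 * SE ^ 2 <= k ^ 2 * SF ^ 2)
      by (apply Rmult_le_compat_l; auto; apply pow_incr; lra).
    assert (c2 : t * (2 * n * SF + k ^ 2 * SF ^ 2) <= t * PP + n * ((1 + Wb) * err)).
    { pose proof (Rmult_le_pos t X2 ltac:(lra) hX2). lra. }
    assert (c3 : t * PP <= t * (2 * n * SE + k ^ 2 * SF ^ 2)) by (apply Rmult_le_compat_l; lra).
    assert (c4 : n * (2 * t * (SE + n * eps)) <= n * (2 * t * SF))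
      by (repeat apply Rmult_le_compat_l; lra).
    apply Rmult_le_reg_l with n; [auto |]. fold err. lra. }
  assert (hte : 0 < t * eps) by nra.
  destruct (INR_unbounded ((1 + Wb) * M / (t * eps))) as [K hK].
  assert (0 <= (1 + Wb) * M) by (apply Rmult_le_pos; lra).
  assert (hKpos : 0 < INR K).
  { apply Rle_lt_trans with (2 := hK). apply Rdiv_le_0_compat; auto. }
  destruct (main K) as [h | h]; [| lra].
  assert (hK2 : (1 + Wb) * M < INR K * (t * eps)).
  { apply Rmult_lt_compat_r with (r := t * eps) in hK; auto.
    unfold Rdiv in hK. rewrite Rmult_assoc, Rinv_l in hK; lra. }
  assert (INR K * t * ((1 + Wb) * Bd * t) <= INR K * t * eps).
  { apply Rmult_le_compat_l; [nra | auto]. }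
  lra.
Qed.

Lemma midpoint_dist_le (Y : MetricSpace) (a b m z : Y) (r : R) :
  CAT0_midpoints Y -> midpoint a b m -> dist z a <= r -> dist z b <= r -> dist z m <= r.
Proof.
  intros [_ hY] hm ha hb. pose proof (hY a b m z hm).
  pose proof (dist_nonneg Y z a). pose proof (dist_nonneg Y z b). pose proof (dist_nonneg Y z m).
  assert (dist z a ^ 2 <= r ^ 2) by (apply pow_incr; lra).
  assert (dist z b ^ 2 <= r ^ 2) by (apply pow_incr; lra).
  pose proof (pow2_ge_0 (dist a b)).
  assert (dist z m ^ 2 <= r ^ 2) by lra. nra.
Qed.

Lemma exists_inv_INR_lt (e : R) : 0 < e -> exists n, / (INR n + 1) < e.
Proof.
  intros he. destruct (INR_unbounded (/ e)) as [n hn]. exists n.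
  rewrite <- (Rinv_inv e). pose proof (Rinv_0_lt_compat e he). pose proof (pos_INR n).
  apply Rinv_lt_contravar; [| lra]. apply Rmult_lt_0_compat; lra.
Qed.

Lemma inv_INR_pos (n : nat) : 0 < / (INR n + 1).
Proof. apply Rinv_0_lt_compat. pose proof (pos_INR n). lra. Qed.

Lemma inv_INR_le (n m : nat) : (n <= m)%nat -> / (INR m + 1) <= / (INR n + 1).
Proof.
  intros h. apply le_INR in h. pose proof (pos_INR n).
  apply Rinv_le_contravar; lra.
Qed.

Lemma complete_cauchy_rate (Y : MetricSpace) (u : nat -> Y) :
  complete Y -> (forall n m, dist (u n) (u m) <= / (INR n + 1) + / (INR m + 1)) ->
  exists l, forall e, 0 < e -> exists N, forall n, (N <= n)%nat -> dist (u n) l < e.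
Proof.
  intros hY hu. apply hY. intros e he.
  destruct (exists_inv_INR_lt (e / 2) ltac:(lra)) as [N hN]. exists N. intros n m hn hm.
  pose proof (hu n m). apply inv_INR_le in hn, hm. lra.
Qed.

(* Near-minimisers of the squared distance to [p0] on smaller and smaller members of the
   family form a Cauchy sequence, by the parallelogram inequality. *)
Lemma directed_closure_inter (Y : MetricSpace) (P : Type) (C : P -> Y -> Prop) (p0 : Y) (B : R) :
  CAT0_midpoints Y -> complete Y -> inhabited P ->
  (forall a b, exists c, forall y, C c y -> C a y /\ C b y) ->
  (forall a y y' m, C a y -> C a y' -> midpoint y y' m -> C a m) ->
  (forall a, exists y, C a y /\ dist p0 y ^ 2 <= B) ->
  exists y, forall a, closure Y (C a) y.
Proof.
  intros [hmid hY] hc [a0] hdir hconv hne.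
  set (E := fun v => exists a, forall y, C a y -> v <= dist p0 y ^ 2).
  destruct (completeness E) as (V & Vub & Vlub).
  { exists B. intros v (a & ha). destruct (hne a) as (y & hy & hb). specialize (ha y hy). lra. }
  { exists 0, a0. intros y _. apply pow2_ge_0. }
  assert (low : forall eta, 0 < eta -> exists a, forall y, C a y -> V - eta <= dist p0 y ^ 2).
  { intros eta h.
    destruct (classic (exists a, forall y, C a y -> V - eta <= dist p0 y ^ 2)) as [|n]; auto.
    exfalso. enough (V <= V - eta) by lra. apply Vlub. intros v (a & ha).
    apply Rnot_lt_le. intros hlt. apply n. exists a. intros y hy. specialize (ha y hy). lra. }
  assert (up : forall a eta, 0 < eta -> exists y, C a y /\ dist p0 y ^ 2 < V + eta).
  { intros a eta h.
    destruct (classic (exists y, C a y /\ dist p0 y ^ 2 < V + eta)) as [|n]; auto.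
    exfalso. enough (V + eta <= V) by lra. apply Vub. exists a. intros y hy.
    apply Rnot_lt_le. intros hlt. apply n. eauto. }
  (* Two points at squared distance below [V + eta] whose midpoint is at least [V - eta] away are at
     squared distance at most [8 * eta]. *)
  set (eta := fun n => (/ (INR n + 1)) ^ 2 / 8).
  assert (heta : forall n, 0 < eta n) by (intros n; unfold eta; pose proof (inv_INR_pos n); nra).
  assert (sel : forall n, exists ay : P * Y,
     (forall y, C (fst ay) y -> V - eta n <= dist p0 y ^ 2) /\
     C (fst ay) (snd ay) /\ dist p0 (snd ay) ^ 2 < V + eta n).
  { intros n. destruct (low (eta n) (heta n)) as (a & ha).
    destruct (up a (eta n) (heta n)) as (y & hy & hy'). exists (a, y). auto. }
  set (s := fun n => proj1_sig (constructive_indefinite_description _ (sel n))).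
  assert (hs := fun n => proj2_sig (constructive_indefinite_description _ (sel n))).
  cbv beta in hs. change (forall n, 
     (forall y, C (fst (s n)) y -> V - eta n <= dist p0 y ^ 2) /\
     C (fst (s n)) (snd (s n)) /\ dist p0 (snd (s n)) ^ 2 < V + eta n) in hs.
  clearbody s.
  assert (near : forall n w, C (fst (s n)) w -> dist p0 w ^ 2 < V + eta n ->
            dist (snd (s n)) w <= / (INR n + 1)).
  { intros n w hw hw'. destruct (hs n) as (h1 & h2 & h3).
    destruct (hmid (snd (s n)) w) as [m hm].
    pose proof (h1 m (hconv _ _ _ _ h2 hw hm)) as h4. pose proof (hY _ _ _ p0 hm) as h5.
    pose proof (inv_INR_pos n) as hp. pose proof (dist_nonneg Y (snd (s n)) w).
    unfold eta in *.
    assert (dist (snd (s n)) w ^ 2 <= (/ (INR n + 1)) ^ 2) by lra. nra. }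
  assert (near2 : forall n a, exists w, C a w /\ dist (snd (s n)) w <= / (INR n + 1)).
  { intros n a. destruct (hdir a (fst (s n))) as (c & hcc).
    destruct (up c (eta n) (heta n)) as (w & hw & hw'). destruct (hcc w hw). eauto. }
  assert (cau : forall n m, dist (snd (s n)) (snd (s m)) <= / (INR n + 1) + / (INR m + 1)).
  { intros n m. destruct (hdir (fst (s n)) (fst (s m))) as (c & hcc).
    destruct (up c (Rmin (eta n) (eta m))) as (w & hw & hw'); [apply Rmin_glb_lt; auto |].
    destruct (hcc w hw). pose proof (Rmin_l (eta n) (eta m)). pose proof (Rmin_r (eta n) (eta m)).
    pose proof (near n w ltac:(auto) ltac:(lra)). pose proof (near m w ltac:(auto) ltac:(lra)).
    pose proof (dist_tri Y (snd (s n)) w (snd (s m))) as tr.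
    rewrite (dist_sym Y w) in tr. lra. }
  destruct (complete_cauchy_rate Y (fun n => snd (s n)) hc cau) as [l hl].
  exists l. intros a e he.
  destruct (hl (e / 2) ltac:(lra)) as [N hN].
  destruct (exists_inv_INR_lt (e / 2) ltac:(lra)) as [N' hN'].
  destruct (near2 (Nat.max N N') a) as (w & hw & hd). exists w. split; auto.
  specialize (hN (Nat.max N N') (Nat.le_max_l _ _)).
  pose proof (inv_INR_le N' (Nat.max N N') (Nat.le_max_r _ _)).
  pose proof (dist_tri Y l (snd (s (Nat.max N N'))) w) as tr.
  cbv beta in hN. rewrite (dist_sym Y l (snd _)) in tr. lra.
Qed.

(** The intersections of finitely many balls with slack [/ (INR n + 1)] form a directed family of
    convex sets. Ball [i0] belongs to each, which by [md_ge_sqr] bounds them by [2 * (e i0 + 1)]. A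
    point of all closures satisfies every inequality since the slack tends to zero. *)
Theorem balls_intersect (k : R) (Y : MetricSpace) (I : Type) (i0 : I) (y : I -> Y) (e : I -> R) :
  0 <= k -> contracting_steps k Y -> CAT0_midpoints Y -> complete Y -> (forall i, 0 <= e i) ->
  (forall l, 0 <= qform (fun i j => e i + e j + k ^ 2 * (e i * e j) - md k (dist (y i) (y j))) l) ->
  exists z, forall i, md k (dist (y i) z) <= e i.
Proof.
  intros hk hY hm hc he hcop.
  destruct (directed_closure_inter Y (list I * nat)
    (fun a z => forall i, In i (i0 :: fst a) -> md k (dist (y i) z) <= e i + / (INR (snd a) + 1))
    (y i0) (2 * (e i0 + 1)) hm hc (inhabits ([], O))) as (z & hz).
  - intros [J n] [J' n']. exists (J ++ J', Nat.max n n'). simpl. intros z hz.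
    pose proof (inv_INR_le n (Nat.max n n') (Nat.le_max_l _ _)).
    pose proof (inv_INR_le n' (Nat.max n n') (Nat.le_max_r _ _)).
    split; intros i hi.
    + apply Rle_trans with (e i + / (INR (Nat.max n n') + 1)); [| lra].
      apply hz. rewrite in_app_iff. tauto.
    + apply Rle_trans with (e i + / (INR (Nat.max n n') + 1)); [| lra].
      apply hz. rewrite in_app_iff. tauto.
  - intros [J n] z z' m h1 h2 h3 i hi. simpl in *.
    apply Rle_trans with (md k (Rmax (dist (y i) z) (dist (y i) z'))).
    + apply md_le; auto. split; [apply dist_nonneg |].
      apply (midpoint_dist_le Y z z'); auto; [apply Rmax_l | apply Rmax_r].
    + apply Rmax_case; auto.
  - intros [J n].
    destruct (finite_balls_approx k Y I (i0 :: J) y e (/ (INR n + 1))) as (z & hz); auto.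
    { discriminate. } { apply inv_INR_pos. }
    exists z. split; [exact hz |].
    pose proof (hz i0 (or_introl eq_refl)) as h0.
    pose proof (md_ge_sqr k (dist (y i0) z) hk (dist_nonneg Y _ _)).
    pose proof (inv_INR_le 0 n ltac:(lia)) as h1. change (INR 0) with 0 in h1.
    rewrite Rplus_0_l, Rinv_1 in h1. lra.
  - exists z. intros i. apply Rnot_lt_le. intros hlt.
    set (b := dist (y i) z + 1). pose proof (dist_nonneg Y (y i) z) as hb.
    destruct (md_lipschitz k b hk ltac:(unfold b; lra)) as (G & hG & lip).
    set (gap := md k (dist (y i) z) - e i). assert (hgap : 0 < gap) by (unfold gap; lra).
    destruct (exists_inv_INR_lt (gap / 2) ltac:(lra)) as [n hn].
    assert (hd : 0 < Rmin 1 (gap / 2 / G)) by (apply Rmin_glb_lt; [lra | repeat apply Rdiv_lt_0_compat; lra]).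
    destruct (hz ([i], n) _ hd) as (w & hw & hzw).
    specialize (hw i ltac:(simpl; auto)). simpl in hw.
    pose proof (Rmin_l 1 (gap / 2 / G)). pose proof (Rmin_r 1 (gap / 2 / G)) as hr.
    pose proof (dist_tri Y (y i) z w) as t1. pose proof (dist_tri Y (y i) w z) as t2.
    rewrite (dist_sym Y w z) in t2. pose proof (dist_nonneg Y (y i) w).
    pose proof (lip (dist (y i) z) (dist (y i) w) ltac:(unfold b; lra) ltac:(unfold b; lra)) as hl.
    pose proof (Rle_abs (md k (dist (y i) z) - md k (dist (y i) w))).
    assert (Rabs (dist (y i) z - dist (y i) w) <= dist z w) by (apply Rabs_le; lra).
    assert (G * Rabs (dist (y i) z - dist (y i) w) <= G * dist z w) by (apply Rmult_le_compat_l; lra).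
    assert (G * dist z w < G * (gap / 2 / G)) by (apply Rmult_lt_compat_l; lra).
    replace (G * (gap / 2 / G)) with (gap / 2) in * by (field; lra).
    unfold gap in *. lra.
Qed.

(** * Extension of families of maps *)


Lemma qform_le {A : Type} (c c' : A -> A -> R) (l : list A) :
  (forall p q, c p q <= c' p q) -> qform c l <= qform c' l.
Proof. intros h. apply lsum_le. intros p _. apply lsum_le. intros q _. apply h. Qed.

Lemma qform_map {A B : Type} (f : A -> B) (c : B -> B -> R) (l : list A) :
  qform c (map f l) = qform (fun p q => c (f p) (f q)) l.
Proof.
  unfold qform. rewrite lsum_map. apply lsum_ext. intros p _. apply lsum_map.
Qed.

Lemma md_dist_eq0 (k : R) (Y : MetricSpace) (x y : Y) :
  0 <= k -> md k (dist x y) <= 0 -> x = y.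
Proof.
  intros hk h. apply dist_eq0. pose proof (dist_nonneg Y x y).
  pose proof (md_ge_sqr k (dist x y) hk H). nra.
Qed.

(* The index set plays the role of the source space, [E i j] that of [md k (dist i j)]; only
   copositivity seen from the points outside the initial domain is needed. *)
Lemma copositive_extension (k : R) (Y : MetricSpace) (I J : Type) (j0 : J)
  (E : I -> I -> R) (s : J -> I) (u : J -> Y) :
  0 <= k -> contracting_steps k Y -> CAT0_midpoints Y -> complete Y ->
  (forall i j, 0 <= E i j) -> (forall i j, E i j = E j i) -> (forall i, E i i = 0) ->
  (forall i l, (forall j, s j <> i) ->
     0 <= qform (fun a b => E i a + E i b + k ^ 2 * (E i a * E i b) - E a b) l) ->
  (forall j j', md k (dist (u j) (u j')) <= E (s j) (s j')) ->
  exists v : I -> Y, (forall j, v (s j) = u j) /\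
    forall i i', md k (dist (v i) (v i')) <= E i i'.
Proof.
  intros hk hY hm hc hE0 hEs hEr hcop hu.
  (* Partial maps are graphs. The initial data are adjoined to [G] rather than contained in it, so
     that the union of an empty chain is good as well. *)
  set (full := fun (G : I * Y -> Prop) p => (exists j, p = (s j, u j)) \/ G p).
  set (good := fun G : I * Y -> Prop => forall p q, full G p -> full G q ->
                 md k (dist (snd p) (snd q)) <= E (fst p) (fst q)).
  destruct (classical_sets.Zorn_bigcup (P := good)) as (G & hG & hmax).
  - intros F hF hch p q hp hq.
    destruct hp as [[j ->] | [C1 hC1 hp]]; destruct hq as [[j' ->] | [C2 hC2 hq]].
    + apply hu.
    + apply (hF C2 hC2 (s j, u j) q); [left; eauto | right; exact hq].
    + apply (hF C1 hC1 p (s j', u j')); [right; exact hp | left; eauto].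
    + destruct (hch C1 C2 hC1 hC2) as [h | h].
      * apply (hF C2 hC2 p q); [right; exact (h p hp) | right; exact hq].
      * apply (hF C1 hC1 p q); [right; exact hp | right; exact (h q hq)].
  - assert (tot : forall i, exists y, full G (i, y)).
    { intros i. destruct (classic (exists y, full G (i, y))) as [|n]; auto.
      destruct (balls_intersect k Y {p | full G p} (exist _ (s j0, u j0) (or_introl (ex_intro _ j0 eq_refl)))
        (fun p => snd (proj1_sig p)) (fun p => E i (fst (proj1_sig p))) hk hY hm hc) as (z & hz).
      { intros; apply hE0. }
      { intros l. assert (hi : forall j, s j <> i).
        { intros j <-. apply n. exists (u j). left. eauto. }
        pose proof (hcop i (map (fun p : {p | full G p} => fst (proj1_sig p)) l) hi) as h.
        rewrite qform_map in h. apply Rle_trans with (1 := h). apply qform_le.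
        intros [p hp] [q hq]. simpl. pose proof (hG p q hp hq). lra. }
      exfalso. apply (hmax (fun p => G p \/ p = (i, z))).
      - split; [intros p hp; now left |]. intros h. apply n. exists z. right. apply h. now right.
      - assert (hz' : forall p, full G p -> md k (dist (snd p) z) <= E i (fst p))
          by (intros p hp; apply (hz (exist _ p hp))).
        assert (red : forall p, full (fun p => G p \/ p = (i, z)) p -> full G p \/ p = (i, z))
          by (unfold full; tauto).
        intros p q hp hq. apply red in hp, hq.
        destruct hp as [hp | ->]; destruct hq as [hq | ->]; simpl.
        + now apply hG.
        + rewrite hEs. auto.
        + rewrite dist_sym. auto.
        + rewrite dist_refl, md_0, hEr. lra. }
    exists (fun i => proj1_sig (constructive_indefinite_description _ (tot i))).
    assert (hv := fun i => proj2_sig (constructive_indefinite_description _ (tot i))).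
    cbv beta in hv. split.
    + intros j. apply (md_dist_eq0 k); auto. rewrite <- (hEr (s j)).
      apply (hG (s j, _) (s j, u j)); [apply hv | left; eauto].
    + intros i i'. apply (hG (i, _) (i', _)); apply hv.
Qed.

(** [real] sends infinite bounds to 0, so the value is meaningful only for bounded families over an
    inhabited type, as in [rsup_spec]. *)
Definition rsup {J : Type} (F : J -> R) : R := real (Lub_Rbar (fun r => exists j, r = F j)).

Lemma rsup_spec {J : Type} (j0 : J) (F : J -> R) (B : R) : (forall j, F j <= B) ->
  (forall j, F j <= rsup F) /\ forall c, (forall j, F j <= c) -> rsup F <= c.
Proof.
  intros hB. unfold rsup.
  destruct (Lub_Rbar_correct (fun r => exists j, r = F j)) as [ub lub].
  destruct (Lub_Rbar (fun r => exists j, r = F j)) as [r | |].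
  - split; [intros j; exact (ub (F j) (ex_intro _ j eq_refl)) |].
    intros c h. apply (lub (Finite c)). intros x (j & ->). apply h.
  - exfalso. apply (lub (Finite B)). intros x (j & ->). apply hB.
  - exfalso. apply (ub (F j0) (ex_intro _ j0 eq_refl)).
Qed.

(* [T] is the distance between [g] and [h] embedded in a space of bounded functions by
   [g |-> (md k (min (dist (g b) y) (2 r g)))_(b, y)], hence a pseudometric. *)
Lemma modulus_pseudometric (k : R) (Y : MetricSpace) (N B : Type) (b0 : B) (ev : N -> B -> Y) (y0 : Y) :
  0 <= k -> (forall g, exists r, forall b, dist y0 (ev g b) <= r) ->
  exists (T : N -> N -> R) (e r : N -> R),
    (forall g h, 0 <= T g h) /\ (forall g, T g g = 0) /\ (forall g h, T g h = T h g) /\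
    (forall g1 g2 g3, T g1 g3 <= T g1 g2 + T g2 g3) /\
    (forall g, 0 <= r g) /\ (forall g, 0 <= e g <= md k (r g)) /\
    (forall g b, md k (dist y0 (ev g b)) <= e g) /\
    (forall g h, e g <= e h + T g h) /\
    (forall g h b b' d, dist (ev g b) (ev g b') <= d -> dist (ev h b) (ev h b') <= d ->
       md k (dist (ev g b) (ev h b')) <= md k d + T g h) /\
    (forall g eta, 0 < eta -> exists delta, 0 < delta /\
       forall h, (forall b, dist (ev g b) (ev h b) <= delta) -> T g h <= eta /\ r h <= r g + 1).
Proof.
  intros hk hbd.
  set (r := fun g => rsup (fun b => dist y0 (ev g b))).
  assert (hr : forall g, (forall b, dist y0 (ev g b) <= r g) /\
            forall c, (forall b, dist y0 (ev g b) <= c) -> r g <= c).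
  { intros g. destruct (hbd g) as [c hc]. now apply (rsup_spec b0 _ c). }
  assert (hr0 : forall g, 0 <= r g).
  { intros g. pose proof (proj1 (hr g) b0). pose proof (dist_nonneg Y y0 (ev g b0)). lra. }
  assert (hd0 : forall g b, md k (dist y0 (ev g b)) <= md k (r g)).
  { intros g b. apply md_le; auto. split; [apply dist_nonneg | apply hr]. }
  set (e := fun g => rsup (fun b => md k (dist y0 (ev g b)))).
  assert (he : forall g, (forall b, md k (dist y0 (ev g b)) <= e g) /\
            forall c, (forall b, md k (dist y0 (ev g b)) <= c) -> e g <= c)
    by (intros g; apply (rsup_spec b0 _ (md k (r g))), hd0).
  (* Without the cap, differences of [md] need not be bounded in [y] and [T] could be infinite. A
     cap of [2 * r g] leaves intact the distance from a value of [g] to a value of any map of no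
     larger radius. *)
  set (phi := fun (g : N) (p : B * Y) => md k (Rmin (dist (ev g (fst p)) (snd p)) (2 * r g))).
  assert (hmin : forall g p, 0 <= Rmin (dist (ev g (fst p)) (snd p)) (2 * r g) <= 2 * r g).
  { intros g p. split; [| apply Rmin_r]. apply Rmin_glb; [apply dist_nonneg | pose proof (hr0 g); lra]. }
  assert (hphi : forall g p, 0 <= phi g p <= md k (2 * r g)).
  { intros g p. pose proof (hmin g p). split; [apply md_nonneg; lra | apply md_le; auto]. }
  set (T := fun g h => rsup (fun p => Rabs (phi g p - phi h p))).
  assert (hT : forall g h, (forall p, Rabs (phi g p - phi h p) <= T g h) /\
            forall c, (forall p, Rabs (phi g p - phi h p) <= c) -> T g h <= c).
  { intros g h. apply (rsup_spec (b0, y0) _ (md k (2 * r g) + md k (2 * r h))).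
    intros p. pose proof (hphi g p). pose proof (hphi h p). apply Rabs_le. lra. }
  assert (hT0 : forall g h, 0 <= T g h).
  { intros g h. pose proof (proj1 (hT g h) (b0, y0)).
    pose proof (Rabs_pos (phi g (b0, y0) - phi h (b0, y0))). lra. }
  assert (hTs : forall g h, T g h <= T h g).
  { intros g h. apply hT. intros p. rewrite Rabs_minus_sym. apply hT. }
  assert (hle : forall g h p, phi g p <= phi h p + T g h).
  { intros g h p. pose proof (proj1 (hT g h) p). pose proof (Rle_abs (phi g p - phi h p)). lra. }
  exists T, e, r.
  split; [auto | split; [| split; [| split; [| split; [auto | split; [| split; [| split; [| split]]]]]]]].
  - intros g. apply Rle_antisym; [| auto]. apply hT. intros p.
    rewrite Rminus_diag, Rabs_R0. lra.
  - intros g h. apply Rle_antisym; auto.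
  - intros g1 g2 g3. apply hT. intros p.
    replace (phi g1 p - phi g3 p) with ((phi g1 p - phi g2 p) + (phi g2 p - phi g3 p)) by ring.
    apply Rle_trans with (1 := Rabs_triang _ _). apply Rplus_le_compat; apply hT.
  - intros g. split; [| now apply he].
    apply Rle_trans with (2 := proj1 (he g) b0). apply md_nonneg; auto. apply dist_nonneg.
  - intros g b. apply he.
  - intros g h. apply he. intros b.
    assert (small : forall g, phi g (b, y0) = md k (dist y0 (ev g b))).
    { intros g'. unfold phi. simpl. rewrite Rmin_left, dist_sym; auto.
      rewrite dist_sym. pose proof (proj1 (hr g') b). pose proof (hr0 g'). lra. }
    rewrite <- small. apply Rle_trans with (1 := hle g h (b, y0)).
    rewrite small. pose proof (proj1 (he h) b). lra.
  (* Test [T] at [y := ev g b], a point whose distance to the values of [h] is uncapped when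
     [r g <= r h]. The other case exchanges the maps, which is why the distance bound is assumed for
     both. *)
  - assert (main : forall g h b b' d, dist (ev g b) (ev g b') <= d -> r g <= r h ->
       md k (dist (ev g b) (ev h b')) <= md k d + T g h).
    { intros g h b b' d hd hgh.
      assert (e1 : phi h (b', ev g b) = md k (dist (ev g b) (ev h b'))).
      { unfold phi. simpl. rewrite Rmin_left, dist_sym; auto.
        pose proof (dist_tri Y (ev h b') y0 (ev g b)) as t. rewrite (dist_sym Y (ev h b') y0) in t.
        pose proof (proj1 (hr h) b'). pose proof (proj1 (hr g) b). lra. }
      rewrite <- e1. apply Rle_trans with (1 := hle h g _). apply Rplus_le_compat; auto.
      unfold phi. simpl. apply md_le; auto. split; [apply (hmin g (b', ev g b)) |].
      apply Rle_trans with (1 := Rmin_l _ _). now rewrite dist_sym. }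
    intros g h b b' d h1 h2. destruct (Rle_or_lt (r g) (r h)).
    + now apply main.
    + rewrite dist_sym. apply Rle_trans with (md k d + T h g).
      * apply main; [now rewrite dist_sym | lra].
      * pose proof (hTs h g). lra.
  - intros g eta heta. pose proof (hr0 g) as hg0.
    destruct (md_lipschitz k (2 * r g + 2) hk ltac:(lra)) as (G & hG & lip).
    (* The factor 2 arises because the cap [2 * r] moves by up to [2 * delta]; the 1 keeps all
       arguments in the range of [lip] and gives [r h <= r g + 1]. *)
    exists (Rmin 1 (eta / (2 * G))).
    assert (hp : 0 < eta / (2 * G)) by (apply Rdiv_lt_0_compat; lra).
    split; [apply Rmin_glb_lt; lra |]. intros h hd.
    set (delta := Rmin 1 (eta / (2 * G))) in *.
    assert (d1 : delta <= 1) by apply Rmin_l.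
    assert (d2 : G * (2 * delta) <= eta).
    { assert (delta <= eta / (2 * G)) as hh by apply Rmin_r.
      apply Rmult_le_compat_l with (r := 2 * G) in hh; [| lra].
      replace (2 * G * (eta / (2 * G))) with eta in hh by (field; lra). lra. }
    assert (r1 : r h <= r g + delta).
    { apply hr. intros b. pose proof (dist_tri Y y0 (ev g b) (ev h b)).
      pose proof (proj1 (hr g) b). pose proof (hd b). lra. }
    assert (r2 : r g <= r h + delta).
    { apply hr. intros b. pose proof (dist_tri Y y0 (ev h b) (ev g b)) as t.
      rewrite (dist_sym Y (ev h b)) in t.
      pose proof (proj1 (hr h) b). pose proof (hd b). lra. }
    split; [| lra]. apply hT. intros [b y]. unfold phi.
    pose proof (hmin g (b, y)) as m1. pose proof (hmin h (b, y)) as m2. simpl in *.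
    eapply Rle_trans; [apply lip; lra |].
    apply Rle_trans with (2 := d2). apply Rmult_le_compat_l; [lra |].
    pose proof (dist_tri Y (ev g b) (ev h b) y) as t1. pose proof (dist_tri Y (ev h b) (ev g b) y) as t2.
    rewrite (dist_sym Y (ev h b) (ev g b)) in t2. pose proof (hd b).
    apply Rabs_le. unfold Rmin in *. repeat destruct (Rle_dec _ _); lra.
Qed.

Fixpoint somes {A : Type} (l : list (option A)) : list A :=
  match l with
  | [] => []
  | Some x :: l => x :: somes l
  | None :: l => somes l
  end.

Lemma lsum_somes {A : Type} (l : list (option A)) (F : A -> R) :
  lsum l (fun o => match o with Some x => F x | None => 0 end) = lsum (somes l) F.
Proof. induction l as [| [x |] l IH]; simpl; rewrite ?IH; lra. Qed.

(* The extension takes place on [N * X] with [E ((g, x), (h, x')) = md k (dist x x') + T g h],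
   enlarged by a point [None] sent to [y0], which keeps the extended maps bounded. Since all
   list weights are nonnegative, it suffices that adding [T] and [e] does not decrease the
   entries of the Gram matrices. *)
Lemma family_extension (k : R) (X Y : MetricSpace) (N B : Type) (inj : B -> X) (ev : N -> B -> Y)
  (y0 : Y) (T : N -> N -> R) (e : N -> R) :
  0 <= k -> expanding_steps k X -> contracting_steps k Y -> CAT0_midpoints Y -> complete Y ->
  (forall g h, 0 <= T g h) -> (forall g, T g g = 0) -> (forall g h, T g h = T h g) ->
  (forall g1 g2 g3, T g1 g3 <= T g1 g2 + T g2 g3) ->
  (forall g, 0 <= e g) -> (forall g h, e g <= e h + T g h) ->
  (forall g b, md k (dist y0 (ev g b)) <= e g) ->
  (forall g h b b', md k (dist (ev g b) (ev h b')) <= md k (dist (inj b) (inj b')) + T g h) ->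
  exists F : N -> X -> Y,
    (forall g b, F g (inj b) = ev g b) /\
    (forall g h x x', md k (dist (F g x) (F h x')) <= md k (dist x x') + T g h) /\
    (forall g x, md k (dist y0 (F g x)) <= e g).
Proof.
  intros hk hX hY hm hc hT0 hTr hTs hTt he0 hel hev hevT.
  assert (mdp : forall x x' : X, 0 <= md k (dist x x'))
    by (intros; apply md_nonneg; auto; apply dist_nonneg).
  set (E := fun i j : option (N * X) =>
    match i, j with
    | Some (g, x), Some (h, x') => md k (dist x x') + T g h
    | Some (g, _), None | None, Some (g, _) => e g
    | None, None => 0
    end).
  destruct (copositive_extension k Y (option (N * X)) (option (N * B)) None E
    (option_map (fun p => (fst p, inj (snd p))))
    (fun j => match j with Some (g, b) => ev g b | None => y0 end)) as (v & hv & hvE); auto.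
  - intros [[g x] |] [[h x'] |]; simpl; auto; try lra.
    pose proof (mdp x x'). pose proof (hT0 g h). lra.
  - intros [[g x] |] [[h x'] |]; simpl; auto. now rewrite dist_sym, hTs.
  - intros [[g x] |]; simpl; auto. rewrite dist_refl, md_0, hTr. lra.
  - intros [[g x] |] l hi; [| now destruct (hi None)].
    (* The Gram matrix at [x], with zero row and column for [None]: its form is that of the list
       stripped of [None]. *)
    set (c := fun a b : option (N * X) =>
      match a with Some (_, p) =>
        match b with Some (_, q) => gram k x p q | None => 0 end | None => 0 end).
    apply Rle_trans with (qform c l).
    + pose proof (gram_copositive k X x (map snd (somes l)) hk hX) as h.
      rewrite qform_map in h. apply Rle_trans with (1 := h). apply Req_le.
      unfold qform, c.
      rewrite <- lsum_somes. apply lsum_ext. intros [[g1 p] |] _.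
      * rewrite <- lsum_somes. apply lsum_ext. intros [[g2 q] |] _; auto.
      * rewrite lsum_const. simpl. lra.
    + apply qform_le. pose proof (pow2_ge_0 k) as hk2.
      intros [[g1 p] |] [[g2 q] |]; simpl; unfold gram.
      * pose proof (hTt g1 g g2) as t. rewrite (hTs g1 g) in t.
        pose proof (mdp x p). pose proof (mdp x q). pose proof (hT0 g g1). pose proof (hT0 g g2).
        assert (md k (dist x p) * md k (dist x q)
                  <= (md k (dist x p) + T g g1) * (md k (dist x q) + T g g2))
          by (apply Rmult_le_compat; lra).
        apply (Rmult_le_compat_l (k ^ 2)) in H3; auto. simpl in *. lra.
      * pose proof (hel g1 g). rewrite (hTs g1 g) in *. pose proof (mdp x p). pose proof (hT0 g g1).
        assert (0 <= (md k (dist x p) + T g g1) * e g) by (apply Rmult_le_pos; [lra | auto]).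
        apply (Rmult_le_pos _ _ hk2) in H2. simpl in *. lra.
      * pose proof (hel g2 g). rewrite (hTs g2 g) in *. pose proof (mdp x q). pose proof (hT0 g g2).
        assert (0 <= e g * (md k (dist x q) + T g g2)) by (apply Rmult_le_pos; [auto | lra]).
        apply (Rmult_le_pos _ _ hk2) in H2. simpl in *. lra.
      * pose proof (he0 g). pose proof (Rmult_le_pos _ _ hk2 (Rmult_le_pos _ _ H H)).
        simpl in *. lra.
  - intros [[g b] |] [[h b'] |]; simpl; auto.
    + rewrite dist_sym. auto.
    + rewrite dist_refl, md_0. lra.
  - exists (fun g x => v (Some (g, x))). split; [| split].
    + intros g b. apply (hv (Some (g, b))).
    + intros g h x x'. apply (hvE (Some (g, x)) (Some (h, x'))).
    + intros g x. pose proof (hvE None (Some (g, x))) as h.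
      pose proof (hv None) as h0. simpl in h0. rewrite h0 in h. exact h.
Qed.

(** * Closed convex hulls and projections *)


Lemma midpoint_sym (Y : MetricSpace) (a b m : Y) : midpoint a b m -> midpoint b a m.
Proof.
  intros [h1 h2]. unfold midpoint. rewrite (dist_sym Y b m), (dist_sym Y m a), (dist_sym Y b a). auto.
Qed.

Lemma midpoint_dist_common (Y : MetricSpace) (p q r m m' : Y) :
  CAT0_midpoints Y -> midpoint p q m -> midpoint p r m' -> dist m m' <= dist q r / 2.
Proof.
  intros [_ hY] h1 h2. pose proof (hY _ _ _ m' h1) as a1. pose proof (hY _ _ _ q h2) as a2.
  destruct h2 as [e1 _]. rewrite (dist_sym Y m' p), e1 in a1.
  rewrite (dist_sym Y m' q), (dist_sym Y m' m) in a1. rewrite (dist_sym Y q p) in a2.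
  pose proof (dist_nonneg Y m m'). pose proof (dist_nonneg Y q r).
  assert (dist m m' ^ 2 <= (dist q r / 2) ^ 2) by nra. nra.
Qed.

(** Convexity of the metric, by passing through the midpoint of the diagonal from [a] to [b']. *)
Lemma midpoint_dist (Y : MetricSpace) (a b a' b' m m' : Y) :
  CAT0_midpoints Y -> midpoint a b m -> midpoint a' b' m' ->
  dist m m' <= (dist a a' + dist b b') / 2.
Proof.
  intros hY h h'. destruct (proj1 hY a b') as [n hn].
  pose proof (midpoint_dist_common Y a b b' m n hY h hn).
  pose proof (midpoint_dist_common Y b' a a' n m' hY (midpoint_sym _ _ _ _ hn) (midpoint_sym _ _ _ _ h')).
  pose proof (dist_tri Y m n m'). lra.
Qed.

Lemma midpoint_unique (Y : MetricSpace) (a b m m' : Y) :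
  CAT0_midpoints Y -> midpoint a b m -> midpoint a b m' -> m = m'.
Proof.
  intros hY h h'. apply dist_eq0. pose proof (midpoint_dist Y a b a b m m' hY h h') as e.
  rewrite !dist_refl in e. pose proof (dist_nonneg Y m m'). lra.
Qed.

Definition midpoint_convex (Y : MetricSpace) (K : Y -> Prop) : Prop :=
  forall a b m, K a -> K b -> midpoint a b m -> K m.

Definition closed (Y : MetricSpace) (K : Y -> Prop) : Prop :=
  forall y, closure Y K y -> K y.

Lemma closure_incl (Y : MetricSpace) (K : Y -> Prop) (y : Y) : K y -> closure Y K y.
Proof. intros h eps he. exists y. rewrite dist_refl. auto. Qed.

Lemma closure_closed (Y : MetricSpace) (K : Y -> Prop) : closed Y (closure Y K).
Proof.
  intros y hy eps he. destruct (hy (eps / 2) ltac:(lra)) as (z & hz & d1).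
  destruct (hz (eps / 2) ltac:(lra)) as (w & hw & d2). exists w. split; auto.
  pose proof (dist_tri Y y z w). lra.
Qed.

Lemma closure_midpoint_convex (Y : MetricSpace) (K : Y -> Prop) :
  CAT0_midpoints Y -> midpoint_convex Y K -> midpoint_convex Y (closure Y K).
Proof.
  intros hY hK a b m ha hb hm eps he.
  destruct (ha eps he) as (a' & ha' & da). destruct (hb eps he) as (b' & hb' & db).
  destruct (proj1 hY a' b') as [m' hm']. exists m'. split; [exact (hK _ _ _ ha' hb' hm') |].
  pose proof (midpoint_dist Y a b a' b' m m' hY hm hm'). lra.
Qed.

Lemma real_set_sup (S : R -> Prop) (a b : R) :
  S a -> (forall s, S s -> s <= b) ->
  exists c, a <= c <= b /\ (forall s, S s -> s <= c) /\
    forall eps, 0 < eps -> exists s, S s /\ c - eps < s.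
Proof.
  intros ha hb. destruct (completeness S) as (c & cub & club); [now exists b | now exists a |].
  exists c. split; [split; [now apply cub | now apply club] | split; [exact cub |]].
  intros eps he. destruct (classic (exists s, S s /\ c - eps < s)) as [|n]; auto.
  exfalso. enough (c <= c - eps) by lra. apply club. intros s hs.
  apply Rnot_lt_le. intros h. apply n. eauto.
Qed.

(* A point of the geodesic outside [K] would lie in a gap of [K], but the middle of the gap
   is in [K]. *)
Lemma geodesic_in_closed_convex (Y : MetricSpace) (K : Y -> Prop) (a b : Y) (g : R -> Y) (t : R) :
  closed Y K -> midpoint_convex Y K -> geodesic Y g a b -> K a -> K b ->
  0 <= t <= dist a b -> K (g t).
Proof.
  intros hcl hcv hg ha hb ht. set (L := dist a b) in *.
  assert (hd : forall s s', 0 <= s <= L -> 0 <= s' <= L -> dist (g s) (g s') = Rabs (s - s'))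
    by apply hg.
  assert (h0 : K (g 0)) by (destruct hg as [-> _]; auto).
  assert (hL : K (g L)) by (destruct hg as (_ & e & _); fold L in e; now rewrite e).
  destruct (real_set_sup (fun s => 0 <= s <= t /\ K (g s)) 0 t) as (c & hc & cub & cap);
    [split; [lra | auto] | intros s [hs _]; lra |].
  (* Signs are reversed to get an infimum: [- d] is the first parameter after [t] at which the
     geodesic is in [K]. *)
  destruct (real_set_sup (fun s => t <= - s <= L /\ K (g (- s))) (- L) (- t)) as (d & hd' & dub & dap);
    [rewrite Ropp_involutive; split; [lra | auto] | intros s [hs _]; lra |].
  assert (Kc : K (g c)).
  { apply hcl. intros eps he. destruct (cap eps he) as (s & [hs Ks] & hlt).
    exists (g s). split; auto. rewrite hd by lra. pose proof (cub s (conj hs Ks)).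
    rewrite Rabs_pos_eq; lra. }
  assert (Kd : K (g (- d))).
  { apply hcl. intros eps he. destruct (dap eps he) as (s & [hs Ks] & hlt).
    exists (g (- s)). split; auto. rewrite hd by lra. pose proof (dub s (conj hs Ks)).
    rewrite Rabs_left1; lra. }
  assert (Km : K (g ((c - d) / 2))).
  { apply (hcv (g c) (g (- d))); auto. unfold midpoint.
    rewrite !hd by lra. rewrite !Rabs_left1 by lra. split; lra. }
  destruct (Rle_or_lt ((c - d) / 2) t) as [h | h].
  - assert (h' : (c - d) / 2 <= c) by (apply cub; split; [lra | exact Km]).
    replace t with c by lra. auto.
  - assert (h' : - ((c - d) / 2) <= d).
    { apply dub. rewrite Ropp_involutive. split; [lra | exact Km]. }
    replace t with (- d) by lra. auto.
Qed.

Lemma Gn_le (Y : MetricSpace) (C : Y -> Prop) (n m : nat) (y : Y) :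
  geodesic_space Y -> (n <= m)%nat -> Gn Y n C y -> Gn Y m C y.
Proof.
  intros hg h. induction h as [| m h IH]; auto. intros hy. apply IH in hy.
  destruct (hg y y) as [g hgeo]. exists y, y, g, 0.
  rewrite dist_refl. do 3 (split; [auto |]). split; [lra | symmetry; apply hgeo].
Qed.

Lemma closed_co_incl (Y : MetricSpace) (C : Y -> Prop) (y : Y) :
  geodesic_space Y -> C y -> closed_co Y C y.
Proof.
  intros hg hy. apply closure_incl. exists 1%nat. split; auto.
  apply (Gn_le Y C 0 1); auto.
Qed.

Lemma closed_co_midpoint_convex (Y : MetricSpace) (C : Y -> Prop) :
  geodesic_space Y -> CAT0_midpoints Y -> midpoint_convex Y (closed_co Y C).
Proof.
  intros hg hY. apply closure_midpoint_convex; auto.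
  intros a b m (n1 & h1 & ha) (n2 & h2 & hb) hm.
  exists (S (Nat.max n1 n2)). split; [lia |].
  destruct (hg a b) as [g hgeo]. exists a, b, g, (dist a b / 2).
  pose proof (dist_nonneg Y a b).
  split; [apply (Gn_le Y C n1); auto; lia |]. split; [apply (Gn_le Y C n2); auto; lia |].
  split; [auto | split; [lra |]].
  apply (midpoint_unique Y a b); auto. now apply geodesic_midpoint.
Qed.

(** The way to transfer a closed midpoint-convex condition from [C] to its hull; applied to balls
    and to thickenings. *)
Lemma closed_co_min (Y : MetricSpace) (C K : Y -> Prop) :
  closed Y K -> midpoint_convex Y K -> (forall y, C y -> K y) ->
  forall y, closed_co Y C y -> K y.
Proof.
  intros hcl hcv hC.
  assert (h : forall n y, Gn Y n C y -> K y).
  { induction n as [| n IH]; auto. intros y (c1 & c2 & g & t & h1 & h2 & hg & ht & ->).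
    apply (geodesic_in_closed_convex Y K c1 c2); auto. }
  intros y hy. apply hcl. intros eps he. destruct (hy eps he) as (z & (n & _ & hz) & hd).
  exists z. eauto.
Qed.

(** The nearest point is encoded by the obtuse angle condition in Pythagorean form, which quantifies
    how much farther the other points of [K] are. *)
Definition projects (Y : MetricSpace) (K : Y -> Prop) (x p : Y) : Prop :=
  K p /\ forall q, K q -> dist x p ^ 2 + dist p q ^ 2 <= dist x q ^ 2.

Lemma nearest_point (Y : MetricSpace) (K : Y -> Prop) (x : Y) :
  CAT0_midpoints Y -> complete Y -> closed Y K -> midpoint_convex Y K -> (exists y, K y) ->
  exists p, K p /\ forall q, K q -> dist x p <= dist x q.
Proof.
  intros hY hc hcl hcv [y0 hy0].
  destruct (real_set_sup (fun s => forall q, K q -> s <= dist x q) 0 (dist x y0))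
    as (r & hr & rub & rap); [intros; apply dist_nonneg | auto |].
  assert (low : forall q, K q -> r <= dist x q).
  { intros q hq. apply Rnot_lt_le. intros h.
    destruct (rap (r - dist x q) ltac:(lra)) as (s & hs & hlt). specialize (hs q hq). lra. }
  assert (app : forall e, 0 < e -> exists q, K q /\ dist x q <= r + e).
  { intros e he. destruct (classic (exists q, K q /\ dist x q <= r + e)) as [|n]; auto.
    exfalso. enough (r + e <= r) by lra. apply rub. intros q hq.
    apply Rnot_lt_le. intros h. apply n. exists q. split; [auto | lra]. }
  destruct (directed_closure_inter Y nat
    (fun n z => K z /\ dist x z <= r + / (INR n + 1)) x ((r + 1) ^ 2) hY hc (inhabits O))
    as (p & hp).
  - intros n m. exists (Nat.max n m). intros z [hz hd].
    pose proof (inv_INR_le n (Nat.max n m) (Nat.le_max_l _ _)).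
    pose proof (inv_INR_le m (Nat.max n m) (Nat.le_max_r _ _)).
    split; split; auto; lra.
  - intros n z z' m [h1 d1] [h2 d2] hm. split; [exact (hcv _ _ _ h1 h2 hm) |].
    apply (midpoint_dist_le Y z z'); auto.
  - intros n. destruct (app (/ (INR n + 1)) (inv_INR_pos n)) as (q & hq & hd).
    exists q. split; auto. apply pow_incr. split; [apply dist_nonneg |].
    pose proof (inv_INR_le 0 n ltac:(lia)) as h1. change (INR 0) with 0 in h1.
    rewrite Rplus_0_l, Rinv_1 in h1. lra.
  - exists p. split.
    + apply hcl. intros e he. destruct (hp O e he) as (z & [hz _] & hd). eauto.
    + intros q hq. apply Rle_trans with r; [| now apply low].
      apply Rnot_lt_le. intros h.
      destruct (exists_inv_INR_lt ((dist x p - r) / 2) ltac:(lra)) as [n hn].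
      destruct (hp n ((dist x p - r) / 2) ltac:(lra)) as (z & [_ hz] & hd).
      pose proof (dist_tri Y x z p) as t. rewrite (dist_sym Y z p) in t. lra.
Qed.

(* Bisecting [p q] towards [p] halves the defect [1 - (d(x,q)^2 - d(x,p)^2) / d(p,q)^2]. *)
Lemma projection_exists (Y : MetricSpace) (K : Y -> Prop) (x : Y) :
  CAT0_midpoints Y -> complete Y -> closed Y K -> midpoint_convex Y K -> (exists y, K y) ->
  exists p, projects Y K x p.
Proof.
  intros hY hc hcl hcv hne.
  destruct (nearest_point Y K x hY hc hcl hcv hne) as (p & hp & hmin).
  exists p. split; [auto |].
  assert (ind : forall n q, K q ->
            dist x p ^ 2 + (1 - (/ 2) ^ n) * dist p q ^ 2 <= dist x q ^ 2).
  { induction n as [| n IH]; intros q hq.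
    - simpl. pose proof (hmin q hq). pose proof (dist_nonneg Y x p).
      assert (dist x p ^ 2 <= dist x q ^ 2) by (apply pow_incr; lra). simpl in *. lra.
    - destruct (proj1 hY p q) as [m hm]. pose proof (IH m (hcv _ _ _ hp hq hm)) as h.
      pose proof (proj2 hY p q m x hm) as h'. rewrite (proj1 hm) in h.
      replace ((/ 2) ^ S n) with (/ 2 * (/ 2) ^ n) by reflexivity.
      set (w := (/ 2) ^ n) in *.
      replace ((1 - w) * (dist p q / 2) ^ 2) with ((1 - w) * dist p q ^ 2 / 4) in h by field.
      lra. }
  intros q hq. apply Rnot_lt_le. intros h.
  set (gap := dist x p ^ 2 + dist p q ^ 2 - dist x q ^ 2).
  assert (hgap : 0 < gap) by (unfold gap; lra).
  pose proof (pow2_ge_0 (dist p q)) as hsq.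
  destruct (pow_lt_1_zero (/ 2) ltac:(rewrite Rabs_pos_eq; lra) (gap / (dist p q ^ 2 + 1)))
    as [N hN]; [apply Rdiv_lt_0_compat; lra |].
  specialize (hN N (le_n N)). pose proof (Rle_abs ((/ 2) ^ N)).
  specialize (ind N q hq).
  assert ((/ 2) ^ N * (dist p q ^ 2 + 1) < gap).
  { apply Rlt_le_trans with (gap / (dist p q ^ 2 + 1) * (dist p q ^ 2 + 1)).
    - apply Rmult_lt_compat_r; lra.
    - apply Req_le. field. lra. }
  pose proof (pow_lt (/ 2) N ltac:(lra)). unfold gap in *. lra.
Qed.

(* In the quadrilateral [x y q p] the sum of the squared diagonals is at most the sum of the
   squared sides. *)
Lemma projection_nonexpansive (Y : MetricSpace) (K : Y -> Prop) (x y p q : Y) :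
  CAT0_midpoints Y -> projects Y K x p -> projects Y K y q -> dist p q <= dist x y.
Proof.
  intros hY [hp h1] [hq h2]. pose proof (h1 q hq) as a1. pose proof (h2 p hp) as a2.
  destruct (proj1 hY x q) as [m hm].
  pose proof (proj2 hY _ _ _ y hm) as b1. pose proof (proj2 hY _ _ _ p hm) as b2.
  pose proof (dist_tri Y y m p) as t. rewrite (dist_sym Y m p) in t.
  rewrite (dist_sym Y y x) in b1. rewrite (dist_sym Y p x) in b2. rewrite (dist_sym Y q p) in a2.
  pose proof (dist_nonneg Y y p). pose proof (dist_nonneg Y p q). pose proof (dist_nonneg Y x y).
  assert (dist y p ^ 2 <= (dist y m + dist p m) ^ 2) by (apply pow_incr; lra).
  pose proof (pow2_ge_0 (dist y m - dist p m)).
  assert (dist p q ^ 2 <= dist x y ^ 2) by lra. nra.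
Qed.

Lemma projects_fixed (Y : MetricSpace) (K : Y -> Prop) (x p : Y) : K x -> projects Y K x p -> p = x.
Proof.
  intros hx [_ h]. specialize (h x hx). rewrite dist_refl in h.
  apply dist_eq0. pose proof (dist_nonneg Y p x). pose proof (pow2_ge_0 (dist x p)). nra.
Qed.

Lemma projects_dist_le (Y : MetricSpace) (K : Y -> Prop) (x p q : Y) :
  projects Y K x p -> K q -> dist x p <= dist x q.
Proof.
  intros [_ h] hq. specialize (h q hq). pose proof (pow2_ge_0 (dist p q)).
  pose proof (dist_nonneg Y x p). pose proof (dist_nonneg Y x q). nra.
Qed.

Definition thickening (Y : MetricSpace) (K : Y -> Prop) (delta : R) (y : Y) : Prop :=
  exists q, K q /\ dist y q <= delta.

(** A point [q] of [K] close to [p'] satisfies [dist x q <= dist x p + 2 * delta], so the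
    Pythagorean inequality gives [dist p q ^ 2 <= delta * (4 * R0 + 4)]; [delta] makes this at most
    [(eta / 2) ^ 2]. It depends on [R0] and [eta] only, as uniformity in [x] requires. *)
Lemma projection_continuous (Y : MetricSpace) (R0 eta : R) : 0 <= R0 -> 0 < eta ->
  exists delta, 0 < delta /\ forall (K K' : Y -> Prop) (x p p' : Y),
    projects Y K x p -> projects Y K' x p' -> dist x p <= R0 ->
    (forall q, K q -> thickening Y K' delta q) -> (forall q, K' q -> thickening Y K delta q) ->
    dist p p' <= eta.
Proof.
  intros hR heta.
  assert (hd : 0 < eta ^ 2 / 4 / (4 * R0 + 4)) by (repeat apply Rdiv_lt_0_compat; nra).
  destruct (pos_below 1 (eta / 2) (eta ^ 2 / 4 / (4 * R0 + 4)) 1) as (delta & d0 & d1 & d2 & d3 & _);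
    try lra.
  exists delta. split; auto. intros K K' x p p' hp hp' hxp hK hK'.
  destruct (hK p (proj1 hp)) as (q' & hq' & dq').
  destruct (hK' p' (proj1 hp')) as (q & hq & dq).
  pose proof (projects_dist_le Y K' x p' q' hp' hq') as a1.
  pose proof (dist_tri Y x p q') as a2. pose proof (dist_tri Y x p' q) as a3.
  pose proof (proj2 hp q hq) as a4. pose proof (dist_tri Y p q p') as a5.
  rewrite (dist_sym Y q p') in a5.
  pose proof (dist_nonneg Y x p). pose proof (dist_nonneg Y p q). pose proof (dist_nonneg Y x q).
  assert (b1 : dist x q ^ 2 <= (dist x p + 2 * delta) ^ 2) by (apply pow_incr; lra).
  assert (b2 : delta * (4 * R0 + 4) <= eta ^ 2 / 4).
  { apply Rmult_le_compat_r with (r := 4 * R0 + 4) in d3; [| lra].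
    unfold Rdiv in d3 at 1. rewrite Rmult_assoc, Rinv_l in d3; lra. }
  assert (delta * dist x p <= delta * R0) by (apply Rmult_le_compat_l; lra).
  assert (delta * delta <= delta * 1) by (apply Rmult_le_compat_l; lra).
  assert (dist p q ^ 2 <= (eta / 2) ^ 2) by lra.
  assert (dist p q <= eta / 2) by nra.
  lra.
Qed.

Lemma thickening_closed_convex (Y : MetricSpace) (K : Y -> Prop) (delta : R) :
  CAT0_midpoints Y -> complete Y -> closed Y K -> midpoint_convex Y K ->
  closed Y (thickening Y K delta) /\ midpoint_convex Y (thickening Y K delta).
Proof.
  intros hY hc hcl hcv. split.
  - intros y hy. destruct (hy 1 ltac:(lra)) as (z0 & (q0 & hq0 & _) & _).
    destruct (nearest_point Y K y hY hc hcl hcv (ex_intro _ q0 hq0)) as (p & hp & hmin).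
    exists p. split; auto. apply Rnot_lt_le. intros h.
    destruct (hy (dist y p - delta) ltac:(lra)) as (z & (q & hq & d1) & d2).
    pose proof (hmin q hq). pose proof (dist_tri Y y z q). lra.
  - intros a b m (qa & ha & da) (qb & hb & db) hm.
    destruct (proj1 hY qa qb) as [q hq]. exists q. split; [exact (hcv _ _ _ ha hb hq) |].
    pose proof (midpoint_dist Y a b qa qb m q hY hm hq). lra.
Qed.

(** The thickened hull is itself closed and convex, so it contains the hull of all points that it
    contains. Used in both directions, it bounds the Hausdorff distance of the hulls. *)
Lemma closed_co_thickening (Y : MetricSpace) (B : Type) (f h : B -> Y) (delta : R) :
  geodesic_space Y -> CAT0_midpoints Y -> complete Y ->
  (forall b, dist (f b) (h b) <= delta) ->
  forall q, closed_co Y (fun y => exists b, y = f b) q ->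
    thickening Y (closed_co Y (fun y => exists b, y = h b)) delta q.
Proof.
  intros hg hY hc hd.
  destruct (thickening_closed_convex Y (closed_co Y (fun y => exists b, y = h b)) delta hY hc) as [t1 t2].
  - apply closure_closed.
  - now apply closed_co_midpoint_convex.
  - apply closed_co_min; auto. intros y (b & ->). exists (h b). split; auto.
    apply closed_co_incl; eauto.
Qed.

Lemma closed_co_ball (Y : MetricSpace) (C : Y -> Prop) (y0 : Y) (r : R) :
  CAT0_midpoints Y -> (forall y, C y -> dist y0 y <= r) ->
  forall y, closed_co Y C y -> dist y0 y <= r.
Proof.
  intros hY. apply (closed_co_min Y C (fun y => dist y0 y <= r)).
  - intros y hy. apply Rnot_lt_le. intros h.
    destruct (hy (dist y0 y - r) ltac:(lra)) as (z & hz & hd).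
    pose proof (dist_tri Y y0 z y) as t. rewrite (dist_sym Y z y) in t. lra.
  - intros a b m ha hb hm. now apply (midpoint_dist_le Y a b).
Qed.

(** * The extension operator and its continuity *)

Lemma dist_le_of_supdist_lt (M Y : MetricSpace) (f h : M -> Y) (delta : R) :
  Rbar_lt (supdist M Y f h) delta -> forall a, dist (f a) (h a) <= delta.
Proof.
  intros hlt a. destruct (Lub_Rbar_correct (fun r => exists a, r = dist (f a) (h a))) as [ub _].
  specialize (ub _ (ex_intro _ a eq_refl)). unfold supdist in hlt.
  destruct (Lub_Rbar _); simpl in *; lra.
Qed.

Lemma supdist_lt_of_dist_le (M Y : MetricSpace) (f h : M -> Y) (c eps : R) :
  c < eps -> (forall a, dist (f a) (h a) <= c) -> Rbar_lt (supdist M Y f h) eps.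
Proof.
  intros hc hd. destruct (Lub_Rbar_correct (fun r => exists a, r = dist (f a) (h a))) as [_ lub].
  apply Rbar_le_lt_trans with (Finite c); [| exact hc]. apply lub. intros r (a & ->). apply hd.
Qed.

Theorem theorem4p4 (kappa : R) (hk : kappa <= 0)
  (X Y : MetricSpace) (hX : CBB kappa X) (hY : CAT kappa Y) (hYc : complete Y)
  (A : X -> Prop) (hA : exists a, A a) :
  exists alpha : NE (sub_ms X A) Y -> NE X Y,
    NE_continuous (sub_ms X A) Y X Y alpha /\
    forall g : NE (sub_ms X A) Y,
      (forall a : sub_ms X A, proj1_sig (alpha g) (proj1_sig a) = proj1_sig g a) /\
      (forall x : X, closed_co Y (fun y => exists a, y = proj1_sig g a)
                                 (proj1_sig (alpha g) x)).
Proof.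
  destruct hA as [a0 ha0]. set (b0 := exist _ a0 ha0 : sub_ms X A).
  set (N := NE (sub_ms X A) Y).
  (* A member of [N] provides the base point [y0]; without one the operator has empty domain. *)
  destruct (classic (inhabited N)) as [[g0] | hN].
  2: { exists (fun g => False_rect _ (hN (inhabits g))). split; [intros g | intros g]; now destruct hN. }
  set (ev := fun (g : N) (b : sub_ms X A) => proj1_sig g b).
  set (y0 := ev g0 b0).
  pose proof (sqrt_pos (- kappa)) as hk0. set (k := sqrt (- kappa)) in *.
  assert (hXs : expanding_steps k X) by now apply CBB_expanding.
  assert (hYs : contracting_steps k Y) by now apply CAT_contracting.
  assert (hYm : CAT0_midpoints Y) by now apply (CAT_CAT0_midpoints kappa).
  assert (hYg : geodesic_space Y) by apply hY.
  destruct (modulus_pseudometric k Y N (sub_ms X A) b0 ev y0 hk0)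
    as (T & e & r & hT0 & hTr & hTs & hTt & hr0 & he & hey & heT & hevT & hTc).
  { intros g. destruct (proj2 (proj2_sig g)) as [B hB]. exists (dist y0 (ev g b0) + B). intros b.
    pose proof (dist_tri Y y0 (ev g b0) (ev g b)). pose proof (hB b0 b). unfold ev in *. lra. }
  destruct (family_extension k X Y N (sub_ms X A) (fun b => proj1_sig b) ev y0 T e)
    as (F & hF1 & hF2 & hF3); auto.
  { intros g; apply he. }
  { intros g h b b'. apply hevT; [apply (proj2_sig g) | apply (proj2_sig h)]. }
  set (K := fun g : N => closed_co Y (fun y => exists a, y = ev g a)).
  assert (hKcl : forall g, closed Y (K g)) by (intros; apply closure_closed).
  assert (hKcv : forall g, midpoint_convex Y (K g)) by (intros; now apply closed_co_midpoint_convex).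
  assert (hKev : forall g b, K g (ev g b)) by (intros; apply closed_co_incl; eauto).
  assert (hball : forall g y, dist y0 y <= r g \/ ~ (md k (dist y0 y) <= e g)).
  { intros g y. destruct (Rle_or_lt (md k (dist y0 y)) (e g)) as [h |]; [left | right; lra].
    apply (md_le_inv k); auto. pose proof (he g). lra. }
  assert (hKr : forall g y, K g y -> dist y0 y <= r g).
  { intros g. apply closed_co_ball; auto. intros y (b & ->).
    destruct (hball g (ev g b)) as [|h]; auto. now destruct h. }
  assert (hFr : forall g x, dist y0 (F g x) <= r g).
  { intros g x. destruct (hball g (F g x)) as [|h]; auto. now destruct h. }
  assert (hproj : forall g y, exists p, projects Y (K g) y p)
    by (intros g y; apply projection_exists; auto; exists (ev g b0); auto).
  set (P := fun g x => proj1_sig (constructive_indefinite_description _ (hproj g (F g x)))).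
  assert (hP : forall g x, projects Y (K g) (F g x) (P g x))
    by (intros g x; exact (proj2_sig (constructive_indefinite_description _ (hproj g (F g x))))).
  clearbody P.
  assert (hPne : forall g, nonexpansive X Y (P g) /\ bounded_map X Y (P g)).
  { intros g. split.
    - intros x x'. apply Rle_trans with (1 := projection_nonexpansive Y (K g) _ _ _ _ hYm (hP g x) (hP g x')).
      apply (md_le_inv k); auto; [apply dist_nonneg |].
      pose proof (hF2 g g x x') as h. rewrite hTr in h. lra.
    - exists (2 * r g). intros x x'.
      pose proof (hKr g _ (proj1 (hP g x))). pose proof (hKr g _ (proj1 (hP g x'))).
      pose proof (dist_tri Y (P g x) y0 (P g x')) as t. rewrite (dist_sym Y (P g x) y0) in t. lra. }
  exists (fun g => exist _ (P g) (hPne g)). split.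
  - intros g eps heps. simpl.
    set (eta := eps / 4). assert (heta : 0 < eta) by (unfold eta; lra).
    destruct (projection_continuous Y (2 * r g + 1) eta) as (d1 & hd1 & cont); auto.
    { pose proof (hr0 g). lra. }
    (* As [md] dominates half the square, [T g h <= eta ^ 2 / 2] forces [F g x] and [F h x] within
       [eta]. *)
    destruct (hTc g (eta ^ 2 / 2) ltac:(nra)) as (d2 & hd2 & hT).
    exists (Rmin d1 d2). split; [now apply Rmin_glb_lt |]. intros h hlt.
    pose proof (dist_le_of_supdist_lt _ _ _ _ _ hlt) as hd.
    pose proof (Rmin_l d1 d2). pose proof (Rmin_r d1 d2).
    destruct (hT h) as [T1 r1].
    { intros b. apply Rle_trans with (1 := hd b). lra. }
    apply supdist_lt_of_dist_le with (c := eta + eta); [unfold eta; lra |]. intros x.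
    (* Projecting [F h x] to [K g] separates the two effects: first the point changes with the set
       fixed, then the set with the point fixed, each costing at most [eta]. *)
    destruct (hproj g (F h x)) as [p hp].
    pose proof (dist_tri Y (P g x) p (P h x)) as tr.
    pose proof (projection_nonexpansive Y (K g) _ _ _ _ hYm (hP g x) hp) as a1.
    assert (a2 : dist (F g x) (F h x) <= eta).
    { pose proof (hF2 g h x x) as m. rewrite dist_refl, md_0 in m.
      pose proof (dist_nonneg Y (F g x) (F h x)) as hn.
      pose proof (md_ge_sqr k _ hk0 hn). nra. }
    assert (a3 : dist p (P h x) <= eta).
    { apply (cont (K g) (K h) (F h x)); auto.
      - pose proof (hFr h x). pose proof (hKr g p (proj1 hp)).
        pose proof (dist_tri Y (F h x) y0 p) as t. rewrite (dist_sym Y (F h x) y0) in t. lra.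
      - apply closed_co_thickening; auto. intros b. apply Rle_trans with (1 := hd b). lra.
      - apply closed_co_thickening; auto. intros b. rewrite dist_sym. apply Rle_trans with (1 := hd b). lra. }
    lra.
  - intros g. split; simpl.
    + intros b. rewrite (projects_fixed Y (K g) (F g (proj1_sig b)) _) by
        (auto; rewrite hF1; apply hKev). apply hF1.
    + intros x. apply (proj1 (hP g x)).
Qed.
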